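(* Let $I\subset\mathbb{R}$ be an interval and let $\beta>0$ be such that $I\subset(-\beta/2,\beta/2)$. Let $g\in S_0(\mathbb{R})$ be such that $\hat g(s)=1$ for all $s\in I$ and $\operatorname{supp}\hat g\subset[-\beta/2,\beta/2]$, and let $\alpha=\beta^{-1}$. Then for every $f\in B^1_I$, $$f(t)=\alpha\sum_{k\in\mathbb{Z}}f(\alpha k)\,g(t-\alpha k)\qquad\text{for all }t\in\mathbb{R},$$ with absolute convergence of the series in $(S_0(\mathbb{R}),\|\cdot\|_{S_0})$, in $(W(\mathbb{R}),\|\cdot\|_W)$ and in $(C_0(\mathbb{R}),\|\cdot\|_\infty)$.
   Context: $C_b(\mathbb{R}^d)$ is the space of bounded continuous functions $\mathbb{R}^d\to\mathbb{C}$ with $\|f\|_\infty=\sup_t|f(t)|$, and $C_0(\mathbb{R})$ is the space of continuous functions on $\mathbb{R}$ vanishing at infinity with norm $\|\cdot\|_\infty$. Let $\Delta(t)=\prod_{j=1}^d\max(1-2|t^{(j)}|,0)$ for $t\in\mathbb{R}^d$, and $\psi_n(t)=\Delta(t-\tfrac12 n)$ for $n\in\mathbb{Z}^d$. The Wiener algebra $W(\mathbb{R}^d)$ is the space of all $f\in C_b(\mathbb{R}^d)$ with $\|f\|_W=\sum_{n\in\mathbb{Z}^d}\|f\cdot\psi_n\|_\infty<\infty$; such functions are integrable. The Fourier transform is $\hat f(s)=\int f(t)e^{-2\pi i s\cdot t}\,dt$. Let $g_0(t)=e^{-\pi t^2}$, $t\in\mathbb{R}$, and for $f\in C_b(\mathbb{R})$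 let $\mathcal{V}_{g_0}f(x,\omega)=\int_{\mathbb{R}}f(t)\,\overline{g_0(t-x)}\,e^{-2\pi i\omega t}\,dt$. The space $S_0(\mathbb{R})$ consists of all $f\in C_b(\mathbb{R})$ with $\mathcal{V}_{g_0}f\in W(\mathbb{R}^{2})$, with norm $\|f\|_{S_0}=\int_{\mathbb{R}^{2}}|\mathcal{V}_{g_0}f(x,\omega)|\,d(x,\omega)$. For an interval $I\subset\mathbb{R}$, $B^1_I=\{f\in W(\mathbb{R}):\operatorname{supp}(\hat f)\subset I\}$. A series is absolutely convergent in a normed space if the sum of the norms of its terms is finite (and the series converges in that norm). *)

(* Defs.v *)
From mathcomp Require Export all_boot all_order all_algebra.
From mathcomp Require Export all_classical all_reals all_analysis.
From mathcomp Require Export complex.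
From mathcomp.analysis.showcase Require summability.

Set Implicit Arguments.
Unset Strict Implicit.
Unset Printing Implicit Defensive.

Export Order.TTheory GRing.Theory Num.Theory.
Export numFieldNormedType.Exports.

Local Open Scope classical_set_scope.
Local Open Scope complex_scope.
Local Open Scope ring_scope.

(* [normc z : R] is the real-valued modulus; the generic [`|z|] on [R[i]] takes
   values in [R[i]] itself. *)
Notation normc := ComplexField.Normc.normc.

Section ComplexValued.
Context {R : realType}.

Definition expi (x : R) : R[i] := cos x +i* sin x.

Definition cintegral (f : R -> R[i]) : R[i] :=
  (\int[lebesgue_measure]_t complex.Re (f t)) +i*
  (\int[lebesgue_measure]_t complex.Im (f t)).

Definition supnorm {T : Type} (f : T -> R[i]) : \bar R :=
  ereal_sup [set (normc (f t))%:E | t in [set: T]].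

(* [R[i]^o] is [R[i]] with the topology of its norm. *)
Definition Cb (T : topologicalType) : set (T -> R[i]) :=
  [set f | continuous (f : T -> R[i]^o) /\ (supnorm f < +oo)%E].

Definition C0 : set (R -> R[i]) :=
  [set f | [/\ continuous (f : R -> R[i]^o),
     (f : R -> R[i]^o) x @[x --> +oo] --> (0 : R[i]^o) &
     (f : R -> R[i]^o) x @[x --> -oo] --> (0 : R[i]^o)]].

End ComplexValued.

Section WienerAlgebra.
Context {R : realType}.

Definition wiener_norm (T : Type) (J : choiceType) (psi : J -> T -> R)
    (f : T -> R[i]) : \bar R :=
  (\esum_(n in [set: J]) supnorm (fun t => f t * (psi n t)%:C)%R)%E.

Definition Delta1 (t : R) : R := Num.max (1 - 2 * `|t|) 0.
Definition psi1 (n : int) (t : R) : R := Delta1 (t - n%:~R / 2).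

Definition Delta2 (t : R * R) : R := Delta1 t.1 * Delta1 t.2.
Definition psi2 (n : int * int) (t : R * R) : R :=
  Delta2 (t.1 - n.1%:~R / 2, t.2 - n.2%:~R / 2).

Definition W1_norm (f : R -> R[i]) : \bar R := wiener_norm psi1 f.
Definition W1 : set (R -> R[i]) := [set f | Cb f /\ (W1_norm f < +oo)%E].

Definition W2_norm (F : R * R -> R[i]) : \bar R := wiener_norm psi2 F.
Definition W2 : set (R * R -> R[i]) := [set F | Cb F /\ (W2_norm F < +oo)%E].

End WienerAlgebra.

Section TimeFrequency.
Context {R : realType}.

Definition fourier (f : R -> R[i]) (s : R) : R[i] :=
  cintegral (fun t => f t * expi (- (2 * pi * s * t))).

Definition supp (h : R -> R[i]) : set R := closure [set s | h s != 0].

Definition gauss (t : R) : R[i] := (expR (- (pi * t ^+ 2)))%:C.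

Definition stft (f : R -> R[i]) (z : R * R) : R[i] :=
  cintegral (fun t => f t * (gauss (t - z.1))^* * expi (- (2 * pi * z.2 * t))).

Definition S0 : set (R -> R[i]) := [set f | Cb f /\ W2 (stft f)].

Definition S0_norm (f : R -> R[i]) : \bar R :=
  (\int[(@lebesgue_measure R \x @lebesgue_measure R)]_z (normc (stft f z))%:E)%E.

Definition B1 (I : set R) : set (R -> R[i]) :=
  [set f | W1 f /\ supp (fourier f) `<=` I].

End TimeFrequency.

Section Series.
Context {R : realType} (V : zmodType) (N : V -> \bar R).

(* Convergence along the net of finite subsets of the index set [int]. *)
Definition series_cvg (u : int -> V) (s : V) : Prop :=
  N (s - summability.partial_sum u F) @[F --> summability.totally] --> 0%E.

Definition abs_series_cvg (X : set V) (u : int -> V) (s : V) : Prop :=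
  [/\ forall k, X (u k), X s,
      (\esum_(k in [set: int]) N (u k) < +oo)%E & series_cvg u s].

End Series.

(* Main.v *)
Require Import Defs.
From mathcomp Require Import finmap measurable_realfun zify ring lra.

(** Poisson summation on the lattice alpha Z, alpha = 1/beta, is the heart of the
matter.  For |s| <= beta/2 the function f(t) e^{-2 pi i s t} has the Fourier
transform r |-> \hat f(s + r), which vanishes at every nonzero multiple of beta
because I lies strictly inside (-beta/2, beta/2).  Hence
\hat f(s) = alpha sum_k f(alpha k) e^{-2 pi i s alpha k}, and truncating the sum
to a finite set F of indices costs at most alpha times the tail
sum_{k notin F} |f(alpha k)| ([bandlimited_poisson]).  As \hat g is 1 on I and 0
off [-beta/2, beta/2], the Fourier transform of
f - alpha sum_{k in F} f(alpha k) g(. - alpha k) lives on [-beta/2, beta/2] and is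
there at most a constant times the tail.  A function whose Fourier transform is
small in this sense is uniformly small ([normc_le_fourier]), so the partial sums
approach beta f uniformly, with an error proportional to the tail
([sampling_bound]).

Fourier inversion is never used.  Both analytic inputs come from one computation
with the Fejer kernel K_m of period T ([fejer_poisson]).  On the one hand the
integral of phi K_m is 1/m times the sum of the numbers \hat phi((j - l)/T) over
j, l < m.  On the other hand it tends to T sum_k phi(T k): K_m concentrates at the points of
T Z, and phi is dominated by a summable sequence of suprema over unit cells, so the
far blocks contribute little uniformly in m.  When T runs through the integers and
grows, T sum_k phi(T k) reduces to its term T phi(0), whereas the Fourier side is
at most T times the sum of the suprema of |\hat phi| over unit cells; dividing by T
gives [normc_le_fourier].  Applied to the windowed function g(u) e^{-pi (u - t)^2},
whose Fourier transform is the short-time Fourier transform of g at time t, the same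
inequality embeds S0 into the Wiener algebra ([S0_amalgam]).

For the convergence in norm, the uniform estimate shows that the remainder after F
is the sum of the terms with k notin F, at every point, and also after applying the
short-time Fourier transform ([tail_remainder]).  Cell suprema are almost
translation invariant: a unit cell translated by any amount meets two cells.  So the
cell suprema of the remainder, hence its W norm and its S0 norm, are at most a
constant times sum_{k notin F} |f(alpha k)|, which tends to 0 because f is in W. *)

Set Implicit Arguments.
Unset Strict Implicit.
Unset Printing Implicit Defensive.

Import ComplexField.Normc.

Local Open Scope classical_set_scope.
Local Open Scope complex_scope.
Local Open Scope ring_scope.

(** * Unordered sums and their tails *)

Section Esum.
Context {R : realType}.
Local Open Scope ereal_scope.

Lemma esumZl (J : choiceType) (D : set J) (a : J -> \bar R) (r : R) :
  (0 <= r)%R -> (forall j, 0 <= a j) ->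
  \esum_(j in D) (r%:E * a j) = r%:E * \esum_(j in D) a j.
Proof.
move=> r0 a0; rewrite /esum -ereal_supZl//; last first.
  by apply/set0P; exists (\sum_(i \in set0) a i); exists set0 => //; split.
congr ereal_sup; apply/seteqP; split => [x [F FD <-]|_ [_ [F FD <-] <-]].
  by exists (\sum_(i \in F) a i); [exists F|rewrite ge0_mule_fsumr].
by exists F => //; rewrite ge0_mule_fsumr.
Qed.

Lemma esum_subset (J : choiceType) (D E : set J) (a : J -> \bar R) :
  (forall j, 0 <= a j) -> D `<=` E ->
  \esum_(j in D) a j <= \esum_(j in E) a j.
Proof.
move=> a0 DE; rewrite [leRHS](esumID D)//.
by rewrite (_ : E `&` D = D) ?leeDl ?esum_ge0//; exact/setIidPr.
Qed.

(** The label s separates the points of a fibre of h, so each of its P values selects a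
part of D on which h is injective; this is how all sums over overlapping
families of cells are compared below. *)
Lemma esum_le_fibre (J K : choiceType) (P : nat) (D : set J) (h : J -> K)
    (s : J -> nat) (c : K -> \bar R) : (forall k, 0 <= c k) ->
  (forall j, D j -> (s j < P)%N) ->
  (forall j j', D j -> D j' -> h j = h j' -> s j = s j' -> j = j') ->
  \esum_(j in D) c (h j) <= P%:R%:E * \esum_(k in [set: K]) c k.
Proof.
move=> c0 sP inj.
have -> : \esum_(j in D) c (h j) =
    \esum_(j in D) \sum_(i < P) if s j == i then c (h j) else 0.
  apply: eq_esum => j Dj; rewrite (bigD1 (Ordinal (sP j Dj)))//= eqxx.
  rewrite big1 ?adde0// => i ni; case: eqP => // si; case/eqP: ni.
  exact: val_inj.
rewrite esum_sum; last by move=> j i _ _; case: ifP.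
have -> (x : \bar R) : P%:R%:E * x = \sum_(i < P) x.
  rewrite mule_natl big_const_ord; elim: P {sP} => // n IH.
  by rewrite iterS -IH muleS.
apply: lee_sum => i _.
rewrite (_ : \esum_(j in D) _ = \esum_(j in D `&` [set j | s j = i]) c (h j)).
  rewrite -(@esum_image R J K _ h); first exact: esum_subset.
  by move=> j j' /[!in_setE] -[Dj sj] -[Dj' sj'] hh; apply: inj => //; rewrite sj sj'.
rewrite esum_mkcondr; apply: eq_esum => j _.
by case: eqP => [e|e]; [rewrite mem_set|rewrite memNset].
Qed.

Lemma esum_le_inj (J K : choiceType) (D : set J) (h : J -> K) (c : K -> \bar R) :
  (forall k, 0 <= c k) -> (forall j j', D j -> D j' -> h j = h j' -> j = j') ->
  \esum_(j in D) c (h j) <= \esum_(k in [set: K]) c k.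
Proof.
move=> c0 inj; rewrite -[leRHS]mul1e.
by apply: (@esum_le_fibre _ _ 1 _ h (fun=> 0%N)) => // j j' Dj Dj' ? _; exact: inj.
Qed.

Lemma esum_swap (J K : choiceType) (D : set J) (E : set K) (a : J -> K -> \bar R) :
  (forall j k, 0 <= a j k) ->
  \esum_(j in D) \esum_(k in E) a j k = \esum_(k in E) \esum_(j in D) a j k.
Proof.
move=> a0; rewrite !esum_esum//.
rewrite (@reindex_esum R _ _ (E `*`` fun=> D) (D `*`` fun=> E) (fun p => (p.2, p.1)))//.
split=> [[k j]|[k j] [k' j'] _ _ /= [-> ->]|[j k]]//=; first by case.
by case=> Dj Ek; exists (k, j).
Qed.

Lemma esum_pair (J K : choiceType) (a : J -> K -> \bar R) :
  (forall j k, 0 <= a j k) ->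
  \esum_(p in [set: J * K]) a p.1 p.2 = \esum_(j in [set: J]) \esum_(k in [set: K]) a j k.
Proof.
move=> a0; rewrite esum_esum//; congr esum; first by apply/seteqP; split.
Qed.

Lemma esum_fsetE (J : choiceType) (F : {fset J}) (a : J -> \bar R) :
  (forall j, 0 <= a j) -> \esum_(j in [set` F]) a j = \sum_(j <- F) a j.
Proof.
by move=> a0; rewrite esum_fset// fsbig_finite//= set_fsetK.
Qed.

Definition tail (J : choiceType) (a : J -> \bar R) (F : {fset J}) : \bar R :=
  \esum_(j in ~` [set` F]) a j.

Lemma tail_ge0 (J : choiceType) (a : J -> \bar R) F : (forall j, 0 <= a j) -> 0 <= tail a F.
Proof. by move=> a0; exact: esum_ge0. Qed.

Lemma tail_le (J : choiceType) (a : J -> \bar R) F : (forall j, 0 <= a j) ->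
  tail a F <= \esum_(j in [set: J]) a j.
Proof. by move=> a0; exact: esum_subset. Qed.

Lemma sum_tail (J : choiceType) (a : J -> \bar R) (F : {fset J}) : (forall j, 0 <= a j) ->
  \esum_(j in [set: J]) a j = \sum_(j <- F) a j + tail a F.
Proof.
by move=> a0; rewrite (esumID [set` F])// !setTI esum_fsetE.
Qed.

Lemma le_tail (J : choiceType) (a : J -> \bar R) (F G : {fset J}) : (forall j, 0 <= a j) ->
  (F `<=` G)%fset -> tail a G <= tail a F.
Proof.
move=> a0 /fsubsetP FG; apply: esum_subset => // j /=; apply: contra_not.
exact: FG.
Qed.

(** A finite set that nearly attains the supremum defining the sum leaves little
outside. *)
Lemma tail_small (J : choiceType) (a : J -> \bar R) (e : R) : (forall j, 0 <= a j) ->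
  \esum_(j in [set: J]) a j < +oo -> (0 < e)%R ->
  exists F : {fset J}, forall G : {fset J}, (F `<=` G)%fset -> tail a G < e%:E.
Proof.
move=> a0 afin e0.
have aR : \esum_(j in [set: J]) a j \is a fin_num.
  by rewrite ge0_fin_numE// esum_ge0.
have [_ [F0 [finF0 _] <-] ltF] := ub_ereal_sup_adherent e0 aR.
exists (fset_set F0) => G /(le_tail a0) /le_lt_trans; apply.
move: ltF; rewrite -/(esum _ _) (sum_tail (fset_set F0))// fsbig_finite//=.
set x := (X in X + tail _ _); set y := tail _ _.
move: aR; rewrite (sum_tail (fset_set F0))// -/x -/y fin_numD.
by case/andP => /fineK <- /fineK <-; rewrite !lte_fin; lra.
Qed.

End Esum.

(** * Complex numbers and complex-valued continuous functions *)

Section Complex.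
Context {R : realType}.
Implicit Types (x y z : R[i]).

Lemma normr_normc z : `|z| = (normc z)%:C.
Proof. by case: z => a b; rewrite normc_def. Qed.

Lemma normc_ge0 z : 0 <= normc z.
Proof. by case: z => a b; exact: sqrtr_ge0. Qed.

Lemma normc_Re z : `|complex.Re z| <= normc z.
Proof.
case: z => a b /=; rewrite -sqrtr_sqr ler_wsqrtr// lerDl; exact: sqr_ge0.
Qed.

Lemma normc_Im z : `|complex.Im z| <= normc z.
Proof.
case: z => a b /=; rewrite -sqrtr_sqr ler_wsqrtr// lerDr; exact: sqr_ge0.
Qed.

Lemma normc_le_ReIm z : normc z <= `|complex.Re z| + `|complex.Im z|.
Proof.
case: z => a b /=; rewrite -(ler_pXn2r (n := 2))// ?nnegrE ?sqrtr_ge0 ?addr_ge0//.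
rewrite sqr_sqrtr ?addr_ge0 ?sqr_ge0// sqrrD !real_normK ?num_real//.
by rewrite -addrA lerD2l lerDr mulrn_wge0 ?mulr_ge0.
Qed.

Lemma normcB x y : normc (x - y) = normc (y - x).
Proof. by rewrite -normcN opprB. Qed.

Lemma normc_real (t : R) : normc t%:C = `|t|.
Proof. by rewrite /= expr0n addr0 sqrtr_sqr. Qed.

Lemma normc_sum (I : Type) (r : seq I) (F : I -> R[i]) :
  normc (\sum_(i <- r) F i) <= \sum_(i <- r) normc (F i).
Proof.
elim: r => [|i r IH]; first by rewrite !big_nil normc0.
by rewrite !big_cons (le_trans (le_normcD _ _))// lerD2l.
Qed.

Lemma ReM x y : complex.Re (x * y) = complex.Re x * complex.Re y - complex.Im x * complex.Im y.
Proof. by case: x y => [a b] [c d]. Qed.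

Lemma ImM x y : complex.Im (x * y) = complex.Re x * complex.Im y + complex.Im x * complex.Re y.
Proof. by case: x y => [a b] [c d]. Qed.

Lemma ReD x y : complex.Re (x + y) = complex.Re x + complex.Re y.
Proof. by case: x y => [a b] [c d]. Qed.

Lemma ImD x y : complex.Im (x + y) = complex.Im x + complex.Im y.
Proof. by case: x y => [a b] [c d]. Qed.

Lemma ReB x y : complex.Re (x - y) = complex.Re x - complex.Re y.
Proof. by case: x y => [a b] [c d]. Qed.

Lemma ImB x y : complex.Im (x - y) = complex.Im x - complex.Im y.
Proof. by case: x y => [a b] [c d]. Qed.

Lemma complex_eq x y : complex.Re x = complex.Re y -> complex.Im x = complex.Im y -> x = y.
Proof. by case: x y => [a b] [c d] /= -> ->. Qed.

Lemma normc_expi (t : R) : normc (expi t) = 1.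
Proof. by rewrite /= cos2Dsin2 sqrtr1. Qed.

Lemma expiD (s t : R) : expi (s + t) = expi s * expi t.
Proof. by apply: complex_eq; rewrite ?ReM ?ImM/= ?cosD ?sinD//; ring. Qed.

Lemma expi0 : expi (0 : R) = 1.
Proof. by rewrite /expi cos0 sin0. Qed.

(** All periodicity of sine and cosine used below is read off from this identity. *)
Lemma expi_period (n : int) : expi (2 * pi * n%:~R) = 1 :> R[i].
Proof.
have H (m : nat) : expi (2 * pi * m%:R) = 1 :> R[i].
  elim: m => [|m IH]; first by rewrite mulr0 expi0.
  rewrite (_ : 2 * pi * m.+1%:R = 2 * pi * m%:R + pi *+ 2); last first.
    by rewrite -natr1 -mulr_natl; ring.
  by rewrite expiD IH mul1r /expi cos2pi sin2pi.
case: n => n; first exact: H.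
have := H n.+1; rewrite NegzE mulrNz mulrN => h.
by rewrite -[LHS]mulr1 -{1}h -expiD addNr expi0.
Qed.

(** The norm of R[i] takes values in R[i] and positive elements of R[i] are real, so
convergence can be tested with the real modulus and a real tolerance. *)
Lemma cvg_normcP (T : Type) (F : set_system T) (FF : Filter F) (f : T -> R[i]) (l : R[i]) :
  ((f : T -> R[i]^o) @ F --> (l : R[i]^o)) <->
  (forall e : R, 0 < e -> \forall u \near F, normc (f u - l) < e).
Proof.
split=> [/cvgrPdist_lt H e e0|H].
  have /H : 0 < e%:C by rewrite ltcR.
  by apply: filterS => u; rewrite normr_normc ltcR normcB.
apply/cvgrPdist_lt => e e0.
have [eI eR] : complex.Im e = 0 /\ 0 < complex.Re e.
  by move: e0; rewrite ltcE/= => /andP[/eqP <-].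
have := H _ eR; apply: filterS => u.
rewrite normcB normr_normc; case: e {e0 H} eI eR => a b /= -> _.
by rewrite complexr0 ltcR.
Qed.

Lemma continuous_ReIm (T : topologicalType) (f : T -> R[i]) :
  continuous (f : T -> R[i]^o) <->
  continuous (fun u => complex.Re (f u)) /\ continuous (fun u => complex.Im (f u)).
Proof.
split=> [cf|[cR cI]]; [split|] => t.
- apply/cvgrPdist_lt => e e0; have /cvg_normcP/(_ _ e0) := cf t.
  by apply: filterS => u; apply: le_lt_trans; rewrite /= -ReB normcB normc_Re.
- apply/cvgrPdist_lt => e e0; have /cvg_normcP/(_ _ e0) := cf t.
  by apply: filterS => u; apply: le_lt_trans; rewrite /= -ImB normcB normc_Im.
- apply/cvg_normcP => e e0; have e20 : 0 < e / 2 by rewrite divr_gt0.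
  have /cvgrPdist_lt/(_ _ e20) hR := cR t; have /cvgrPdist_lt/(_ _ e20) hI := cI t.
  near=> u; rewrite (le_lt_trans (normc_le_ReIm _))//.
  rewrite ReB ImB [e]splitr ltrD//= distrC.
    by near: u; exact: hR.
  by near: u; exact: hI.
Unshelve. all: by end_near. Qed.

Lemma supnorm_ge (T : Type) (f : T -> R[i]) t : ((normc (f t))%:E <= supnorm f)%E.
Proof. by apply: ereal_sup_ubound; exists t. Qed.

Lemma supnorm_le (T : Type) (f : T -> R[i]) (M : \bar R) :
  (forall t, ((normc (f t))%:E <= M)%E) -> (supnorm f <= M)%E.
Proof. by move=> fM; apply: ge_ereal_sup => _ [t _ <-]. Qed.

End Complex.

(** * Cutting an integral into countably many cells; translation invariance *)

Section Fibre.
Local Open Scope ereal_scope.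

(** The fibres of a map to a countable type form a countable measurable partition,
enumerated here through [choice.pickle]; empty sets fill the unused codes. *)
Lemma ge0_integral_fibre d (T : measurableType d) (R : realType)
    (mu : {measure set T -> \bar R}) (J : countType) (kap : T -> J)
    (G : T -> \bar R) :
  (forall j, measurable (kap @^-1` [set j])) -> measurable_fun [set: T] G ->
  (forall x, 0 <= G x) ->
  \int[mu]_x G x = \esum_(j in [set: J]) \int[mu]_(x in kap @^-1` [set j]) G x.
Proof.
move=> mk mG G0.
pose A n := [set x | choice.pickle (kap x) = n].
have AE n : A n = if choice.pickle_inv n is Some j then kap @^-1` [set j] else set0.
  apply/seteqP; split => x; rewrite /A/=; first by move=> <-; rewrite choice.pickleK_inv.
  by case: choice.pickle_inv (@pickle_invK J n) => //= j /= <- ->.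
have mA n : measurable (A n) by rewrite AE; case: choice.pickle_inv.
have UA : \bigcup_n A n = setT.
  by apply/seteqP; split => // x _; exists (choice.pickle (kap x)).
have tA : trivIset setT A.
  apply/trivIsetP => i j _ _ ij; apply/seteqP; split => // x [/= xi xj].
  by case/eqP: ij; rewrite -xi -xj.
rewrite -[X in integral _ X]UA ge0_integral_bigcup ?UA//.
rewrite nneseries_esumT; last by move=> n; exact: integral_ge0.
rewrite (esumID [set n | exists j : J, choice.pickle j = n]); last first.
  by move=> n _; exact: integral_ge0.
rewrite setTI setTI [X in _ + X]esum1 ?adde0; last first.
  move=> n nj; rewrite (_ : A n = set0) ?integral_set0//.
  apply/seteqP; split => // x Ax; apply: nj; by exists (kap x).
rewrite (_ : [set n | _] = choice.pickle @` [set: J]); last first.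
  by apply/seteqP; split => n [j]; exists j.
rewrite esum_image; last by move=> j j' _ _; apply: (pcan_inj choice.pickleK).
by apply: eq_esum => j _; rewrite AE choice.pickleK_inv.
Qed.

(** Translation preserves the length of intervals, hence Lebesgue measure by
uniqueness; the general case follows from the nonnegative one by splitting f into
its positive and negative parts. *)
Lemma integral_translate (R : realType) (f : R -> \bar R) (s : R) :
  measurable_fun setT f ->
  \int[lebesgue_measure]_t f (t + s)%R = \int[lebesgue_measure]_t f t.
Proof.
move=> mf.
have mphi : measurable_fun [set: measurableTypeR R] ((fun t => t + s)%R : _ -> measurableTypeR R).
  exact: measurable_funD.
have H (g : R -> \bar R) : measurable_fun setT g -> (forall t, 0 <= g t) ->
   \int[lebesgue_measure]_t g (t + s)%R = \int[lebesgue_measure]_t g t.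
  move=> mg g0.
  rewrite -[LHS](@ge0_integral_pushforward _ _ (measurableTypeR R) (measurableTypeR R) R _ mphi lebesgue_measure setT g)//.
  apply: eq_measure_integral => //= A mA AS; apply/esym/lebesgue_measure_unique => //= _ [[a b]] _ <-.
  rewrite /pushforward [X in _ = lebesgue_measure X](_ : _ = `](a - s)%R, (b - s)%R]%classic); last first.
    by apply/seteqP; split => x /=; rewrite !in_itv/= ltrBlDr lerBrDr.
  rewrite !lebesgue_measure_itv/= !lte_fin ltrD2r; case: ifP => // _.
  by rewrite -!EFinB opprB addrA subrK.
rewrite integralE [RHS]integralE -(H f^\+)//; last exact: measurable_funepos.
rewrite -(H f^\-)//; last exact: measurable_funeneg.
congr (_ - _); apply: eq_integral => x _ /=; first by rewrite !funeposE.
by rewrite !funenegE.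
Qed.

End Fibre.

(** * Functions dominated by a summable sequence of cell bounds *)

Section Amalgam.
Context {R : realType}.
Notation mu := (@lebesgue_measure R).
Implicit Types (f g : R -> R[i]) (c : int -> \bar R).

Lemma floor_fibre (n : int) :
  (fun t : R => Num.floor t) @^-1` [set n] = `[n%:~R, (n + 1)%:~R[%classic.
Proof.
apply/seteqP; split => t /=; rewrite in_itv/=.
  by move=> <-; rewrite floor_le floorD1_gt.
by move=> h; apply/eqP; rewrite floor_eq.
Qed.

Lemma measurable_floor_fibre (n : int) :
  measurable ((fun t : R => Num.floor t) @^-1` [set n]).
Proof. by rewrite floor_fibre; exact: measurable_itv. Qed.

Lemma lebesgue_measure_floor_fibre (n : int) :
  mu ((fun t : R => Num.floor t) @^-1` [set n]) = 1%E.
Proof.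
rewrite floor_fibre; apply: etrans (lebesgue_measure_itv _) _.
by rewrite /= lte_fin ltr_int ltzD1 lexx -EFinB -rmorphB/= addrC addKr.
Qed.

(** Weights take extended-real values, so that an infinite sum of weights needs no
finiteness proof before it is used as a weight. *)
Definition nnsummable (J : choiceType) (c : J -> \bar R) :=
  (forall n, 0 <= c n)%E /\ (\esum_(n in [set: J]) c n < +oo)%E.

Lemma nnsummable_lty (J : choiceType) (c : J -> \bar R) n : nnsummable c -> (c n < +oo)%E.
Proof.
case=> c0; apply: le_lt_trans; rewrite -(esum_set1 (t := n))//.
exact: esum_subset.
Qed.

Lemma ge0_integral_le_cells (a : R -> \bar R) c :
  measurable_fun setT a -> (forall t, 0 <= a t)%E ->
  (forall t, a t <= c (Num.floor t))%E ->
  (\int[mu]_t a t <= \esum_(n in [set: int]) c n)%E.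
Proof.
move=> ma a0 ac.
rewrite (@ge0_integral_fibre _ _ R mu int (fun t : R => Num.floor t) a)//; last first.
  exact: measurable_floor_fibre.
apply: le_esum => n _.
have mn := measurable_floor_fibre n.
apply: (@le_trans _ _ (\int[mu]_(x in (fun t : R => Num.floor t) @^-1` [set n]) c n)%E).
  apply: ge0_le_integral => //; first exact: measurable_funTS.
  by move=> x /= <-.
rewrite integral_cst//.
by rewrite [X in (_ * X)%E](_ : _ = 1%E) ?mule1//; exact: lebesgue_measure_floor_fibre.
Qed.

(** The unit cell containing t is [floor t, floor t + 1), so c bounds |f| cell by cell. *)
Definition celldom c f := forall t, ((normc (f t))%:E <= c (Num.floor t))%E.

(** This is the Wiener algebra, described by bounds on unit cells instead of the
functions psi_n; see [W1_amalgam] and [amalgam_W1]. *)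
Definition amalgam f := continuous (f : R -> R[i]^o) /\
  exists2 c, nnsummable c & celldom c f.

Lemma real_integrable_le_cells (a : R -> R) c : continuous a -> nnsummable c ->
  (forall t, (`|a t|%:E <= c (Num.floor t))%E) ->
  mu.-integrable setT (EFin \o a) /\
  (\int[mu]_t `|a t|%:E <= \esum_(n in [set: int]) c n)%E.
Proof.
move=> ca [c0 cfin] ac.
have ma : measurable_fun setT a by exact: continuous_measurable_fun.
have le : (\int[mu]_t `|a t|%:E <= \esum_(n in [set: int]) c n)%E.
  apply: ge0_integral_le_cells => //.
  by apply/measurable_EFinP; exact: measurableT_comp.
split; last exact: le.
apply/integrableP; split; first exact/measurable_EFinP.
exact: le_lt_trans cfin.
Qed.

Definition cintegrable f := mu.-integrable setT (EFin \o (fun t => complex.Re (f t))) /\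
  mu.-integrable setT (EFin \o (fun t => complex.Im (f t))).

Lemma amalgam_integrable f : amalgam f -> cintegrable f.
Proof.
move=> [/continuous_ReIm[cR cI] [c sc fc]]; split.
  apply: (real_integrable_le_cells cR sc _).1 => t; apply: le_trans (fc t).
  by rewrite lee_fin normc_Re.
apply: (real_integrable_le_cells cI sc _).1 => t; apply: le_trans (fc t).
by rewrite lee_fin normc_Im.
Qed.

(** The factor 2 comes from estimating the real and imaginary parts separately. *)
Lemma cintegral_le f c : continuous (f : R -> R[i]^o) -> nnsummable c -> celldom c f ->
  ((normc (cintegral f))%:E <= 2%:R%:E * \esum_(n in [set: int]) c n)%E.
Proof.
move=> /continuous_ReIm[cR cI] sc fc.
have hR t : (`|complex.Re (f t)|%:E <= c (Num.floor t))%E.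
  by apply: le_trans (fc t); rewrite lee_fin normc_Re.
have hI t : (`|complex.Im (f t)|%:E <= c (Num.floor t))%E.
  by apply: le_trans (fc t); rewrite lee_fin normc_Im.
have H (a : R -> R) : mu.-integrable setT (EFin \o a) /\
  (\int[mu]_t `|a t|%:E <= \esum_(n in [set: int]) c n)%E ->
  (`|\int[mu]_t a t|%:E <= \esum_(n in [set: int]) c n)%E.
  move=> [ia]; apply: le_trans.
  rewrite EFin_normr_Rintegral//; exact: le_abse_integral (measurable_int _ ia).
have := leeD (H _ (real_integrable_le_cells cR sc hR)) (H _ (real_integrable_le_cells cI sc hI)).
rewrite mule_natl mule2n; apply: le_trans.
by rewrite -EFinD lee_fin (le_trans (normc_le_ReIm _)).
Qed.

Lemma cintegralD f g : cintegrable f -> cintegrable g ->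
  cintegral (fun t => f t + g t) = cintegral f + cintegral g.
Proof.
move=> [fR fI] [gR gI]; apply: complex_eq; rewrite ?ReD ?ImD/=.
  by rewrite -RintegralD//; apply: eq_Rintegral => t _; rewrite ReD.
by rewrite -RintegralD//; apply: eq_Rintegral => t _; rewrite ImD.
Qed.

Lemma integrable_lin (a b : R -> R) (r s : R) :
  mu.-integrable setT (EFin \o a) -> mu.-integrable setT (EFin \o b) ->
  mu.-integrable setT (EFin \o (fun t => r * a t + s * b t)).
Proof.
move=> ia ib; have := integrableD _ (integrableZl _ r ia) (integrableZl _ s ib).
exact.
Qed.

Lemma Rintegral_lin (a b : R -> R) (r s : R) :
  mu.-integrable setT (EFin \o a) -> mu.-integrable setT (EFin \o b) ->
  \int[mu]_t (r * a t + s * b t) = r * \int[mu]_t a t + s * \int[mu]_t b t.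
Proof.
move=> ia ib; rewrite RintegralD//; first by rewrite !RintegralZl.
  exact: (integrableZl _ r ia).
exact: (integrableZl _ s ib).
Qed.

Lemma cintegrableZ (z : R[i]) f : cintegrable f -> cintegrable (fun t => z * f t).
Proof.
move=> [fR fI]; split.
  have := integrable_lin (complex.Re z) (- complex.Im z) fR fI.
  by apply: eq_integrable => // t _ /=; rewrite ReM mulNr.
have := integrable_lin (complex.Im z) (complex.Re z) fR fI.
by apply: eq_integrable => // t _ /=; rewrite ImM addrC.
Qed.

Lemma cintegralZ (z : R[i]) f : cintegrable f ->
  cintegral (fun t => z * f t) = z * cintegral f.
Proof.
move=> [fR fI]; apply: complex_eq; rewrite ?ReM ?ImM/=.
  have := Rintegral_lin (complex.Re z) (- complex.Im z) fR fI.
  by rewrite mulNr => <-; apply: eq_Rintegral => t _; rewrite ReM mulNr.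
have := Rintegral_lin (complex.Re z) (complex.Im z) fI fR => <-.
by apply: eq_Rintegral => t _; rewrite ImM.
Qed.

Lemma cintegrableD f g : cintegrable f -> cintegrable g ->
  cintegrable (fun t => f t + g t).
Proof.
move=> [fR fI] [gR gI]; split.
  have := integrableD measurableT fR gR.
  by apply: eq_integrable => // t _ /=; rewrite ReD.
have := integrableD measurableT fI gI.
by apply: eq_integrable => // t _ /=; rewrite ImD.
Qed.

Lemma cintegrable0 : cintegrable (fun=> 0).
Proof. by split; exact: integrable0. Qed.

Lemma cintegrable_sum (I : Type) (r : seq I) (F : I -> R -> R[i]) :
  (forall i, cintegrable (F i)) -> cintegrable (fun t => \sum_(i <- r) F i t).
Proof.
move=> iF; elim: r => [|i r IH].
  by under eq_fun do rewrite big_nil; exact: cintegrable0.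
by under eq_fun do rewrite big_cons; exact: cintegrableD.
Qed.

Lemma cintegral_sum (I : Type) (r : seq I) (F : I -> R -> R[i]) :
  (forall i, cintegrable (F i)) ->
  cintegral (fun t => \sum_(i <- r) F i t) = \sum_(i <- r) cintegral (F i).
Proof.
move=> iF; elim: r => [|i r IH].
  under eq_fun do rewrite big_nil; rewrite big_nil.
  by apply: complex_eq => /=; rewrite Rintegral_cst//= mul0r.
under eq_fun do rewrite big_cons.
by rewrite big_cons cintegralD ?IH//; exact: cintegrable_sum.
Qed.

Lemma cintegral_translate f (s : R) : cintegrable f ->
  cintegral (fun t => f (t + s)) = cintegral f.
Proof.
move=> [fR fI]; apply: complex_eq; rewrite /= /Rintegral; congr fine.
  exact: (integral_translate s (measurable_int _ fR)).
exact: (integral_translate s (measurable_int _ fI)).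
Qed.

End Amalgam.

(** * Stability of the amalgam class *)

Section AmalgamClosure.
Context {R : realType}.
Implicit Types (f g : R -> R[i]) (c : int -> \bar R).

Lemma nnsummable_le (J : choiceType) (b c : J -> \bar R) (M : R) : nnsummable c ->
  (forall n, 0 <= b n)%E ->
  (\esum_(n in [set: J]) b n <= M%:E * \esum_(n in [set: J]) c n)%E -> nnsummable b.
Proof.
move=> [c0 cfin] b0 bc; split=> //; apply: le_lt_trans bc _.
have : \esum_(n in [set: J]) c n \is a fin_num by rewrite ge0_fin_numE// esum_ge0.
by move=> /fineK <-; rewrite -EFinM ltry.
Qed.

Lemma nnsummableD (J : choiceType) (b c : J -> \bar R) : nnsummable b -> nnsummable c ->
  nnsummable (fun n => b n + c n)%E.
Proof.
move=> [b0 bfin] [c0 cfin]; split; first by move=> n; exact: adde_ge0.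
by rewrite esumD// lte_add_pinfty.
Qed.

Lemma nnsummableZ (J : choiceType) (c : J -> \bar R) (M : R) : 0 <= M -> nnsummable c ->
  nnsummable (fun n => M%:E * c n)%E.
Proof.
move=> M0 sc; apply: (nnsummable_le (M := M) sc); first by move=> n; rewrite mule_ge0// ?lee_fin// sc.1.
by rewrite esumZl//; case: sc.
Qed.

Lemma nnsummable_inj (J K : choiceType) (c : K -> \bar R) (h : J -> K) : nnsummable c ->
  injective h -> nnsummable (fun n => c (h n)).
Proof.
move=> sc hi; apply: (_ : nnsummable _ -> _); last exact: sc.
case=> c0 cfin; split=> //; apply: le_lt_trans cfin.
by apply: esum_le_inj => // j j' _ _; exact: hi.
Qed.

Lemma continuous_mulc (T : topologicalType) (f g : T -> R[i]) :
  continuous (f : T -> R[i]^o) -> continuous (g : T -> R[i]^o) ->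
  continuous ((fun t => f t * g t) : T -> R[i]^o).
Proof. by move=> cf cg t; apply: cvgM; [exact: cf|exact: cg]. Qed.

Lemma continuous_addc (T : topologicalType) (f g : T -> R[i]) :
  continuous (f : T -> R[i]^o) -> continuous (g : T -> R[i]^o) ->
  continuous ((fun t => f t + g t) : T -> R[i]^o).
Proof. by move=> cf cg t; apply: cvgD; [exact: cf|exact: cg]. Qed.

Lemma continuous_cstc (T : topologicalType) (z : R[i]) : continuous ((fun=> z) : T -> R[i]^o).
Proof. by move=> t; apply: cvg_cst. Qed.

Lemma continuous_translate f (s : R) : continuous (f : R -> R[i]^o) ->
  continuous ((fun t => f (t + s)) : R -> R[i]^o).
Proof.
move=> cf t; apply: (continuous_comp (f := fun t => t + s) (g := (f : R -> R[i]^o))).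
  by apply: cvgD; [exact: cvg_id|exact: cvg_cst].
exact: cf.
Qed.

Lemma continuous_expi (w : R) : continuous ((fun t : R => expi (w * t)) : R -> R[i]^o).
Proof.
apply/continuous_ReIm; split => t /=.
  apply: (continuous_comp (f := fun t => w * t)); last exact: continuous_cos.
  by apply: cvgM; [exact: cvg_cst|exact: cvg_id].
apply: (continuous_comp (f := fun t => w * t)); last exact: continuous_sin.
by apply: cvgM; [exact: cvg_cst|exact: cvg_id].
Qed.

Lemma celldomM (h f : R -> R[i]) (M : R) c : celldom c f -> (forall t, normc (h t) <= M) ->
  celldom (fun n => M%:E * c n)%E (fun t => h t * f t).
Proof.
move=> fc hM t; rewrite normcM EFinM; apply: lee_pmul => //.
- by rewrite lee_fin normc_ge0.
- by rewrite lee_fin normc_ge0.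
- by rewrite lee_fin.
Qed.

Lemma celldomD f g (b c : int -> \bar R) : celldom b f -> celldom c g ->
  celldom (fun n => b n + c n)%E (fun t => f t + g t).
Proof.
move=> fb gc t; apply: le_trans (leeD (fb t) (gc t)).
by rewrite -EFinD lee_fin le_normcD.
Qed.

Lemma amalgamD f g : amalgam f -> amalgam g -> amalgam (fun t => f t + g t).
Proof.
move=> [cf [b sb fb]] [cg [c sc gc]]; split; first exact: (continuous_addc cf cg).
by exists (fun n => b n + c n)%E; [exact: nnsummableD|exact: celldomD].
Qed.

Lemma amalgamM (h f : R -> R[i]) (M : R) : continuous (h : R -> R[i]^o) ->
  (forall t, normc (h t) <= M) -> amalgam f -> amalgam (fun t => h t * f t).
Proof.
move=> ch hM [cf [c sc fc]]; split; first exact: (continuous_mulc ch cf).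
exists (fun n => M%:E * c n)%E; last exact: celldomM.
by apply: nnsummableZ => //; apply: le_trans (hM 0); exact: normc_ge0.
Qed.

Lemma amalgamZ (z : R[i]) f : amalgam f -> amalgam (fun t => z * f t).
Proof. by apply: amalgamM; [exact: continuous_cstc|move=> t; exact: lexx]. Qed.

Lemma amalgam_expi (w : R) f : amalgam f -> amalgam (fun t => expi (w * t) * f t).
Proof.
by apply: (amalgamM (M := 1)); [exact: continuous_expi|move=> t; rewrite normc_expi].
Qed.

Lemma amalgam0 : amalgam (fun=> 0 : R[i]).
Proof.
split; first exact: continuous_cstc.
exists (fun=> 0%E); last by move=> t; rewrite normc0.
by split=> //; rewrite esum1.
Qed.

Lemma amalgam_sum (I : Type) (r : seq I) (F : I -> R -> R[i]) :
  (forall i, amalgam (F i)) -> amalgam (fun t => \sum_(i <- r) F i t).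
Proof.
move=> aF; elim: r => [|i r IH].
  by under eq_fun do rewrite big_nil; exact: amalgam0.
by under eq_fun do rewrite big_cons; exact: amalgamD.
Qed.

(** A cell translated by a number with integer part q meets the two cells at distances
q and q + 1.  The action h is a parameter because both the cells of the line and
the cells of the plane, moved in the time direction only, get translated. *)
Definition shift_weight (J : Type) (h : J -> int -> J) (q : int) (c : J -> \bar R) (n : J) :=
  (c (h n q) + c (h n (q + 1)%R))%E.

Lemma floor_add (t s : R) : Num.floor (t + s) = Num.floor t + Num.floor s \/
  Num.floor (t + s) = Num.floor t + (Num.floor s + 1).
Proof.
have := floor_itv t; have := floor_itv s.
set p := Num.floor t; set q := Num.floor s.
rewrite !intrD => /andP[s1 s2] /andP[t1 t2].
have [h|h] := ltP (t + s) (p + q + 1)%:~R; [left|right]; apply/eqP; rewrite floor_eq.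
  by rewrite h !intrD andbT lerD.
by rewrite !intrD in h *; apply/andP; split; lra.
Qed.

Lemma celldom_translate f c (s : R) : (forall n, 0 <= c n)%E -> celldom c f ->
  celldom (shift_weight +%R (Num.floor s) c) (fun t => f (t + s)).
Proof.
move=> c0 fc t; apply: le_trans (fc _) _; rewrite /shift_weight.
by case: (floor_add t s) => ->; [rewrite leeDl|rewrite leeDr].
Qed.

Lemma esum_shift_weight (J : choiceType) (h : J -> int -> J) q (c : J -> \bar R) :
  (forall n, 0 <= c n)%E -> (forall q, injective (h^~ q)) ->
  (\esum_(n in [set: J]) shift_weight h q c n <= 2%:R%:E * \esum_(n in [set: J]) c n)%E.
Proof.
move=> c0 hi; rewrite /shift_weight esumD// mule_natl mule2n.
by apply: leeD; apply: esum_le_inj => // j j' _ _; exact: hi.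
Qed.

Lemma shift_weight_ge0 (J : choiceType) (h : J -> int -> J) q (c : J -> \bar R) :
  (forall n, 0 <= c n)%E -> forall n, (0 <= shift_weight h q c n)%E.
Proof. by move=> c0 n; exact: adde_ge0. Qed.

Lemma nnsummable_shift_weight (J : choiceType) (h : J -> int -> J) q (c : J -> \bar R) :
  nnsummable c -> (forall q, injective (h^~ q)) -> nnsummable (shift_weight h q c).
Proof.
move=> sc hi; apply: (nnsummable_le (M := 2%:R) sc); first exact: shift_weight_ge0 sc.1.
exact: esum_shift_weight sc.1 hi.
Qed.

Lemma addz_inj (q : int) : injective (fun n : int => n + q).
Proof. exact: addIr. Qed.

Lemma amalgam_translate f (s : R) : amalgam f -> amalgam (fun t => f (t + s)).
Proof.
move=> [cf [c sc fc]]; split; first exact: continuous_translate.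
exists (shift_weight +%R (Num.floor s) c); last exact: celldom_translate sc.1 fc.
exact: nnsummable_shift_weight sc addz_inj.
Qed.

End AmalgamClosure.

(** * The Wiener norms and cell bounds *)

Section Wiener.
Context {R : realType}.
Implicit Types (f g : R -> R[i]).

Lemma psi1_ge0 n (t : R) : 0 <= psi1 n t.
Proof. by rewrite /psi1 /Delta1 le_max lexx orbT. Qed.

Lemma psi1_le1 n (t : R) : psi1 n t <= 1.
Proof. by rewrite /psi1 /Delta1 ge_max ler01 andbT gerBl mulr_ge0. Qed.

(** Only psi_(2n), psi_(2n+1) and psi_(2n+2) can be nonzero on the cell [n, n + 1), and
consecutive tents add up to 1 between their peaks. *)
Lemma sum_psi1_ge1 (t : R) (n : int) : Num.floor t = n ->
  1 <= psi1 (2 * n) t + psi1 (2 * n + 1) t + psi1 (2 * n + 2) t.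
Proof.
move=> nE; have /andP[] := floor_itv t; rewrite nE intrD => nt tn.
rewrite /psi1 /Delta1 !intrD !intrM; set x : R := n%:~R.
have mge (a b : R) : a <= Num.max a b by rewrite le_max lexx.
have mge0 (a : R) : 0 <= Num.max a 0 by rewrite le_max lexx orbT.
have e1 : 2%:~R * x / 2 = x by rewrite mulrAC divff ?mul1r// pnatr_eq0.
have e2 : (2%:~R * x + 1%:~R) / 2 = x + 1 / 2 by rewrite mulrDl e1.
have e3 : (2%:~R * x + 2%:~R) / 2 = x + 1 by rewrite mulrDl e1 divff// pnatr_eq0.
rewrite e1 e2 e3; have [h|h] := leP t (x + 1/2).
  apply: (@le_trans _ _ ((1 - 2 * `|t - x|) + (1 - 2 * `|t - (x + 1 / 2)|) + 0)).
    by rewrite ger0_norm ?subr_ge0// ler0_norm; lra.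
  by apply: lerD => //; apply: lerD.
apply: (@le_trans _ _ (0 + (1 - 2 * `|t - (x + 1 / 2)|) + (1 - 2 * `|t - (x + 1)|))).
  have -> : `|t - (x + 1 / 2)| = t - (x + 1 / 2) by rewrite ger0_norm//; lra.
  have -> : `|t - (x + 1)| = x + 1 - t by rewrite ler0_norm; lra.
  by lra.
by apply: lerD => //; apply: lerD.
Qed.

(** psi_n vanishes outside the open interval from (n - 1)/2 to (n + 1)/2, which is
contained in the union of this cell and the next one. *)
Definition first_cell (n : int) : int := ((n - 1) %/ 2)%Z.

Lemma psi1_neq0 n (t : R) : psi1 n t != 0 ->
  Num.floor t = first_cell n \/ Num.floor t = first_cell n + 1.
Proof.
move=> h.
have {h} : `|t - n%:~R / 2| < 1 / 2.
  rewrite ltNge; apply: contra h => h; apply/eqP/max_idPr.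
  by lra.
rewrite ltr_norml => /andP[h1 h2].
have e := divz_eq (n - 1) 2; rewrite -/(first_cell n) in e.
have r0 : (0 <= (n - 1) %% 2)%Z by rewrite modz_ge0.
have r2 : ((n - 1) %% 2 < 2)%Z by rewrite ltz_pmod.
have {e} : n = first_cell n * 2 + 1 \/ n = first_cell n * 2 + 2 by lia.
move: (first_cell n) => k nk.
have [kt|kt] := ltP t (k + 1)%:~R; [left|right]; apply/eqP; rewrite floor_eq.
  rewrite kt andbT; case: nk h1 => ->; rewrite !intrD intrM; lra.
by rewrite kt/=; case: nk h2 => ->; rewrite !intrD intrM; lra.
Qed.

(** Two consecutive integers share a first cell, whence 4 = 2 (cells) * 2 (indices). *)
Lemma esum_first_cell (c : int -> \bar R) : (forall n, 0 <= c n)%E ->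
  (\esum_(n in [set: int]) (c (first_cell n) + c (first_cell n + 1)%R) <=
   4%:R%:E * \esum_(n in [set: int]) c n)%E.
Proof.
move=> c0; rewrite esumD//.
have H (i : int) : (\esum_(n in [set: int]) c (first_cell n + i)%R <=
   2%:R%:E * \esum_(n in [set: int]) c n)%E.
  apply: (@esum_le_fibre _ _ _ 2 _ (fun n => first_cell n + i)%R (fun n => absz ((n - 1) %% 2)%Z)) => //.
    by move=> n _; have := ltz_pmod (n - 1) (isT : 0 < 2 :> int); lia.
  move=> n m _ _; rewrite /first_cell; have := divz_eq (n - 1) 2; have := divz_eq (m - 1) 2.
  have := modz_ge0 (n - 1) (isT : 2 != 0 :> int); have := modz_ge0 (m - 1) (isT : 2 != 0 :> int).
  by lia.
have -> (x : \bar R) : (4%:R%:E * x = 2%:R%:E * x + 2%:R%:E * x)%E.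
  by rewrite -ge0_muleDl ?lee_fin// -EFinD -natrD.
apply: leeD; last exact: H.
by apply: le_trans (H 0); apply: le_esum => n _; rewrite addr0.
Qed.

Lemma psi2E n (t : R * R) : psi2 n t = psi1 n.1 t.1 * psi1 n.2 t.2.
Proof. by []. Qed.

Lemma normc_psi1 f n t : normc (f t * (psi1 n t)%:C) = normc (f t) * psi1 n t.
Proof. by rewrite normcM normc_real ger0_norm// psi1_ge0. Qed.

Lemma normc_psi2 (F : R * R -> R[i]) n t :
  normc (F t * (psi2 n t)%:C) = normc (F t) * (psi1 n.1 t.1 * psi1 n.2 t.2).
Proof. by rewrite normcM normc_real psi2E ger0_norm// mulr_ge0 ?psi1_ge0. Qed.

Lemma W1_norm_le f (c : int -> \bar R) : (forall n, 0 <= c n)%E -> celldom c f ->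
  (W1_norm f <= 4%:R%:E * \esum_(n in [set: int]) c n)%E.
Proof.
move=> c0 fc; apply: le_trans (esum_first_cell c0); apply: le_esum => n _.
apply: supnorm_le => t; rewrite normc_psi1.
have [->|/psi1_neq0 h] := eqVneq (psi1 n t) 0; first by rewrite mulr0 adde_ge0.
apply: (@le_trans _ _ (normc (f t))%:E).
  by rewrite lee_fin ler_piMr ?normc_ge0 ?psi1_le1.
by apply: le_trans (fc t) _; case: h => ->; [rewrite leeDl|rewrite leeDr].
Qed.

Definition celldom2 (c : int * int -> \bar R) (F : R * R -> R[i]) :=
  forall z, ((normc (F z))%:E <= c (Num.floor z.1, Num.floor z.2))%E.

(** The estimate of the one-dimensional case is applied in each variable in turn:
16 = 4 * 4. *)
Lemma W2_norm_le F c : (forall n, 0 <= c n)%E -> celldom2 c F ->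
  (W2_norm F <= 16%:R%:E * \esum_(n in [set: int * int]) c n)%E.
Proof.
move=> c0 Fc.
pose b k l := (c (k, l) + c (k + 1, l)%R)%E.
have b0 k l : (0 <= b k l)%E by rewrite adde_ge0.
apply: (@le_trans _ _ (\esum_(n in [set: int * int])
   (b (first_cell n.1) (first_cell n.2) + b (first_cell n.1) (first_cell n.2 + 1)%R))%E).
  apply: le_esum => n _; apply: supnorm_le => z; rewrite normc_psi2.
  have [->|/psi1_neq0 h1] := eqVneq (psi1 n.1 z.1) 0; first by rewrite mul0r mulr0 adde_ge0.
  have [->|/psi1_neq0 h2] := eqVneq (psi1 n.2 z.2) 0; first by rewrite !mulr0 adde_ge0.
  apply: (@le_trans _ _ (normc (F z))%:E).
    by rewrite lee_fin ler_piMr ?normc_ge0// mulr_ile1 ?psi1_ge0 ?psi1_le1.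
  apply: le_trans (Fc z) _; case: h2 => ->.
    apply: (@le_trans _ _ (b (first_cell n.1) (first_cell n.2))); last by rewrite leeDl.
    by case: h1 => ->; [rewrite leeDl|rewrite leeDr].
  apply: (@le_trans _ _ (b (first_cell n.1) (first_cell n.2 + 1)%R)); last by rewrite leeDr.
  by case: h1 => ->; [rewrite leeDl|rewrite leeDr].
rewrite (@esum_pair _ _ _ (fun k l => b (first_cell k) (first_cell l) + b (first_cell k) (first_cell l + 1)%R)%E); last first.
  by move=> k l; rewrite adde_ge0.
apply: (@le_trans _ _ (\esum_(k in [set: int]) (4%:R%:E * \esum_(l in [set: int]) b (first_cell k) l))%E).
  by apply: le_esum => k _; exact: esum_first_cell.
rewrite esumZl//; last by move=> k; exact: esum_ge0.
have -> : 16%:R = 4%:R * 4%:R :> R by rewrite -natrM.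
rewrite EFinM -muleA.
apply: lee_wpmul2l; first by rewrite lee_fin.
pose d k := \esum_(l in [set: int]) c (k, l).
apply: (@le_trans _ _ (\esum_(k in [set: int]) (d (first_cell k) + d (first_cell k + 1)%R))%E).
  by apply: le_esum => k _; rewrite /b esumD.
rewrite (_ : \esum_(n in [set: int * int]) c n = \esum_(k in [set: int]) d k).
  by apply: esum_first_cell => k; exact: esum_ge0.
by rewrite -(@esum_pair _ _ _ (fun k l => c (k, l)))//; apply: eq_esum => -[].
Qed.

Lemma W1_amalgam f : W1 f -> amalgam f.
Proof.
move=> [[cf _] Wf]; split => //.
pose b n := supnorm (fun t => f t * (psi1 n t)%:C).
have b0 n : (0 <= b n)%E by apply: le_trans (supnorm_ge _ 0); rewrite lee_fin normc_ge0.
have sb : nnsummable b by split.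
exists (fun n => b (2 * n)%R + b (2 * n + 1)%R + b (2 * n + 2)%R)%E.
  by apply: nnsummableD; first apply: nnsummableD; apply: nnsummable_inj => // n m; lia.
move=> t; set n := Num.floor t.
apply: (@le_trans _ _ (normc (f t) * (psi1 (2 * n) t + psi1 (2 * n + 1) t + psi1 (2 * n + 2) t))%:E).
  by rewrite lee_fin ler_peMr ?normc_ge0 ?(sum_psi1_ge1 (erefl n)).
rewrite !mulrDr !EFinD -!normc_psi1.
by apply: leeD; [apply: leeD|]; exact: supnorm_ge.
Qed.

Lemma amalgam_W1 f : amalgam f -> W1 f.
Proof.
move=> [cf [c [c0 cfin] fc]]; split.
  split=> //; apply: le_lt_trans cfin; apply: supnorm_le => t.
  apply: le_trans (fc t) _; rewrite -(esum_set1 (t := Num.floor t))//.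
  exact: esum_subset.
rewrite /=; apply: le_lt_trans (W1_norm_le c0 fc) _.
have : \esum_(n in [set: int]) c n \is a fin_num by rewrite ge0_fin_numE// esum_ge0.
by move=> /fineK <-; rewrite -EFinM ltry.
Qed.

Lemma W2_celldom2 F : W2 F -> exists2 c, nnsummable c & celldom2 c F.
Proof.
move=> [[cF _] WF].
pose b n := supnorm (fun t => F t * (psi2 n t)%:C).
have b0 n : (0 <= b n)%E by apply: le_trans (supnorm_ge _ (0, 0)); rewrite lee_fin normc_ge0.
have sb : nnsummable b by split.
(* A pair (i, j) with entries among 0, 1, 2 selects one of the three tents that are
   nonzero on a cell, in each variable. *)
pose B (i j : int) (n : int * int) := b (2 * n.1 + i, 2 * n.2 + j)%R.
have sB i j : nnsummable (B i j).
  by apply: nnsummable_inj => // -[n1 n2] [m1 m2] [] h1 h2; congr (_, _); lia.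
pose B' i n := (B i 0%R n + B i 1%R n + B i 2%R n)%E.
exists (fun n => B' 0%R n + B' 1%R n + B' 2%R n)%E.
  have sB' i : nnsummable (B' i) := nnsummableD (nnsummableD (sB i 0) (sB i 1)) (sB i 2).
  exact: (nnsummableD (nnsummableD (sB' 0) (sB' 1)) (sB' 2)).
move=> z; set n := Num.floor z.1; set m := Num.floor z.2.
have hn := sum_psi1_ge1 (erefl n); have hm := sum_psi1_ge1 (erefl m).
apply: (@le_trans _ _ (normc (F z) * ((psi1 (2 * n) z.1 + psi1 (2 * n + 1) z.1 + psi1 (2 * n + 2) z.1) *
   (psi1 (2 * m) z.2 + psi1 (2 * m + 1) z.2 + psi1 (2 * m + 2) z.2)))%:E).
  by rewrite lee_fin ler_peMr ?normc_ge0// -[leLHS]mulr1 ler_pM.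
have H (i j : int) : ((normc (F z) * (psi1 (2 * n + i) z.1 * psi1 (2 * m + j) z.2))%R%:E <= B i j (n, m))%E.
  by rewrite -(normc_psi2 F (2 * n + i, 2 * m + j)); exact: supnorm_ge.
have {}H (i : int) : ((normc (F z) * (psi1 (2 * n + i) z.1 *
    (psi1 (2 * m) z.2 + psi1 (2 * m + 1) z.2 + psi1 (2 * m + 2) z.2)))%R%:E <= B' i (n, m))%E.
  rewrite !mulrDr !EFinD; apply: leeD; [apply: leeD|]; last 2 first.
  - exact: H.
  - exact: H.
  - by rewrite -[in X in psi1 X z.2](addr0 (2 * m)); exact: H.
have E (x u v w y : R) : x * ((u + v + w) * y) = x * (u * y) + x * (v * y) + x * (w * y).
  by ring.
rewrite E !EFinD; apply: leeD; [apply: leeD|]; last 2 first.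
- exact: H.
- exact: H.
- by rewrite -[in X in psi1 X z.1](addr0 (2 * n)); exact: H.
Qed.

End Wiener.

(** * Blocks centred at the points of a lattice *)

Section Blocks.
Context {R : realType}.
Variable T : R.
Hypothesis T0 : 0 < T.

(** The index of the point of the lattice T Z nearest to t. *)
Definition block (t : R) : int := Num.floor (t / T + 1 / 2).

Lemma block_fibre (k : int) :
  block @^-1` [set k] = `[(T * (k%:~R - 1 / 2)), (T * (k%:~R - 1 / 2) + T)[%classic :> set R.
Proof.
have E (t : R) : t = T * (t / T) by rewrite mulrC divfK ?gt_eqF.
apply/seteqP; split => t /=; rewrite in_itv/=.
  move=> <-; rewrite /block; have := floor_itv (t / T + 1 / 2); rewrite intrD => /andP[h1 h2].
  rewrite [X in _ <= X < _]E [X in _ <= _ < X](_ : _ = T * ((Num.floor (t / T + 1 / 2))%:~R + 1 / 2)); last lra.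
  by rewrite ler_pM2l// ltr_pM2l//; apply/andP; split; lra.
rewrite [X in _ <= X < _]E [X in _ <= _ < X](_ : _ = T * (k%:~R + 1 / 2)); last lra.
rewrite ler_pM2l// ltr_pM2l// => /andP[h1 h2]; apply/eqP; rewrite floor_eq intrD.
by apply/andP; split; lra.
Qed.

Lemma measurable_block_fibre (k : int) : measurable (block @^-1` [set k]).
Proof. by rewrite block_fibre; exact: measurable_itv. Qed.

(** A block of length T meets boundedly many unit cells, and a unit cell meets
boundedly many blocks, so summing the weights of the cells that meet a block
yields a summable weight on blocks. *)
Lemma block_majorant (c : int -> \bar R) : nnsummable c ->
  exists2 b, nnsummable b & forall t, (c (Num.floor t) <= b (block t))%E.
Proof.
move=> sc; have [c0 _] := sc.
(* Q bounds the number of cells that meet a block, P the number of blocks that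
   start in a given cell. *)
pose Q := (`|Num.floor (T + 1)|%N.+1).
have QT : T + 1 < Q%:R.
  rewrite /Q; have : 0 <= Num.floor (T + 1) by rewrite floor_ge0 addr_ge0 // ltW.
  have := floorD1_gt (T + 1); case: (Num.floor (T + 1)) => n // h _.
  by rewrite absz_nat -natr1; move: h; rewrite intrD.
pose P := (`|Num.floor (1 / T)|%N.+1).
have PT : 1 < P%:R * T.
  rewrite -ltr_pdivrMr// /P; have : 0 <= Num.floor (1 / T) by rewrite floor_ge0 divr_ge0// ltW.
  have := floorD1_gt (1 / T); case: (Num.floor (1 / T)) => n // h _.
  by rewrite absz_nat -natr1; move: h; rewrite intrD.
pose n k := Num.floor (T * (k%:~R - 1 / 2)).
exists (fun k => \sum_(i < Q) c (n k + i)%R)%E; last first.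
  move=> t; have : (block @^-1` [set block t]) t by [].
  rewrite block_fibre /= in_itv/= => /andP[h1 h2].
  set k := block t in h1 h2 *.
  have le : n k <= Num.floor t by exact: le_floor.
  have lt : Num.floor t < n k + Q.
    rewrite floor_lt_int intrD; have := floorD1_gt (T * (k%:~R - 1 / 2)).
    by rewrite -/(n k) intrD -[Q%:~R]/(Q%:R : R); move: QT h2; lra.
  have iQ : (`|Num.floor t - n k|%N < Q)%N by lia.
  rewrite (bigD1 (Ordinal iQ))//= (_ : n k + _ = Num.floor t); last by lia.
  by rewrite leeDl// sume_ge0.
apply: (nnsummable_le (M := (Q * P)%:R) sc); first by move=> k; exact: sume_ge0.
rewrite esum_sum//.
apply: (@le_trans _ _ (\sum_(i < Q) (P%:R%:E * \esum_(k in [set: int]) c k))%E).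
  apply: lee_sum => i _.
  apply: (@esum_le_fibre _ _ _ P _ (fun k => n k + i)%R (fun k => absz (k %% P)%Z)) => //.
    by move=> k _; have := ltz_pmod k (isT : 0 < P%:Z :> int); have := modz_ge0 k (isT : P%:Z != 0); lia.
  move=> j k _ _ /addIr njk sjk.
  have {}sjk : (j %% P)%Z = (k %% P)%Z.
    by have := modz_ge0 k (isT : P%:Z != 0); have := modz_ge0 j (isT : P%:Z != 0); lia.
  have lt (x y : int) : n x = n y -> y < x + P.
    move=> nxy; have := floor_le (T * (x%:~R - 1 / 2)); have := floorD1_gt (T * (y%:~R - 1 / 2)).
    rewrite -/(n x) -/(n y) nxy intrD => h1 h2.
    have : T * (y%:~R - x%:~R) < T * P%:R by rewrite !mulrBr in h1 h2 *; lra.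
    rewrite ltr_pM2l// ltrBlDl -[P%:R]/(P%:~R) -intrD ltr_int; lia.
  have := lt _ _ njk; have := lt _ _ (esym njk).
  have := divz_eq j P; have := divz_eq k P; rewrite sjk.
  move: (j %/ P)%Z (k %/ P)%Z (k %% P)%Z => x y z -> -> h1 h2.
  suff -> : x = y by [].
  have : y - x < 1 by rewrite -(ltr_pM2r (isT : 0 < P%:Z)); lia.
  have : x - y < 1 by rewrite -(ltr_pM2r (isT : 0 < P%:Z)); lia.
  by lia.
rewrite big_const_ord natrM EFinM -muleA [leRHS]mule_natl.
by elim: Q {QT} => // q IH; rewrite iterS muleS; exact: leeD.
Qed.

End Blocks.

(** * The Fejer kernel *)

Section FejerKernel.
Context {R : realType}.
Notation mu := (@lebesgue_measure R).
Variable T : R.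
Hypothesis T0 : 0 < T.

Lemma sqr_normcE (z : R[i]) : ((normc z) ^+ 2)%:C = z * z^*.
Proof.
case: z => a b /=; rewrite sqr_sqrtr ?addr_ge0 ?sqr_ge0//.
by apply: complex_eq; rewrite ?ReM ?ImM/=; ring.
Qed.

Lemma expiN (x : R) : expi (- x) = (expi x)^*.
Proof. by rewrite /expi cosN sinN. Qed.

Lemma expiX (x : R) (n : nat) : expi x ^+ n = expi (x * n%:R).
Proof.
elim: n => [|n IH]; first by rewrite mulr0 expi0.
by rewrite exprS IH -expiD -[n.+1%:R]natr1 mulrDr mulr1 addrC.
Qed.

Definition dirichlet (m : nat) (t : R) : R[i] :=
  \sum_(j < m) expi (- (2 * pi * (j%:R / T) * t)).

(** The Fejer kernel of period T, normalised to have mean 1 over a period. *)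
Definition fejer (m : nat) (t : R) : R := normc (dirichlet m t) ^+ 2 / m%:R.

Lemma fejer_ge0 m t : 0 <= fejer m t.
Proof. by rewrite divr_ge0 ?sqr_ge0. Qed.

(** Expanding |D|^2 = D * conj D keeps the kernel as a double sum over j and l; this form
pairs directly with the Fourier transform and needs no count of the pairs with a
given difference. *)
Lemma fejerE m t : (fejer m t)%:C = (m%:R^-1)%:C *
  \sum_(j < m) \sum_(l < m) expi (- (2 * pi * ((j%:R - l%:R) / T) * t)).
Proof.
rewrite /fejer rmorphM/= mulrC; congr (_ * _); rewrite sqr_normcE /dirichlet.
rewrite mulr_suml; apply: eq_bigr => j _.
rewrite rmorph_sum/= mulr_sumr; apply: eq_bigr => l _.
by rewrite -expiN -expiD opprK; congr expi; ring.
Qed.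

Lemma fejer_cosE m t : fejer m t = m%:R^-1 *
  \sum_(j < m) \sum_(l < m) cos (2 * pi * ((j%:Z - l%:Z)%:~R / T) * t).
Proof.
have /(congr1 (@complex.Re R)) := fejerE m t.
rewrite /= => ->; rewrite ReM /= mul0r subr0; congr (_ * _).
rewrite (raddf_sum (@complex.Re R : Rcomplex R -> R)); apply: eq_bigr => j _.
rewrite (raddf_sum (@complex.Re R : Rcomplex R -> R)); apply: eq_bigr => l _ /=.
by rewrite cosN intrB.
Qed.

(** The Dirichlet sum is geometric with ratio w = e^{-2 pi i t/T}, so
|w - 1| |D| = |w^m - 1| <= 2, while |w - 1|^2 = 2 - 2 cos(2 pi t/T). *)
Lemma fejer_decay m t : (0 < m)%N ->
  fejer m t * (2 - 2 * cos (2 * pi * (t / T))) <= 4 / m%:R.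
Proof.
move=> m0; set w := expi (- (2 * pi * (t / T))).
have -> : 2 - 2 * cos (2 * pi * (t / T)) = normc (w - 1) ^+ 2.
  rewrite /w /expi cosN sinN /= sqr_sqrtr ?addr_ge0 ?sqr_ge0//.
  rewrite oppr0 addr0 sqrrN sqrrB1.
  have := cos2Dsin2 (2 * pi * (t / T)); set c := cos _; set s := sin _ => h.
  by rewrite -mulr_natl; lra.
have -> : fejer m t = normc (\sum_(j < m) w ^+ j) ^+ 2 / m%:R.
  rewrite /fejer /dirichlet; congr (normc _ ^+ 2 / _); apply: eq_bigr => j _.
  by rewrite expiX; congr expi; ring.
rewrite mulrAC ler_wpM2r ?invr_ge0// -exprMn -normcM [X in normc X]mulrC -subrX1.
have -> : 4 = 2 ^+ 2 :> R by rewrite -natrX.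
rewrite ler_pXn2r ?nnegrE ?normc_ge0//.
rewrite (le_trans (le_normcD _ _))// normcN normc1 expiX normc_expi; lra.
Qed.

Lemma continuous_cosM (w : R) : continuous (fun t : R => cos (w * t)).
Proof. by have /continuous_ReIm[] := @continuous_expi R w. Qed.

Lemma continuous_fejer m : continuous (fejer m : R -> R).
Proof.
rewrite (_ : fejer m = fun t => m%:R^-1 *
  \sum_(j < m) \sum_(l < m) cos (2 * pi * ((j%:Z - l%:Z)%:~R / T) * t)); last first.
  by apply/funext => t; exact: fejer_cosE.
move=> t; apply: cvgM; first exact: cvg_cst.
apply: cvg_big => [|j _]; first exact: add_continuous.
by apply: cvg_big => [|l _]; [exact: add_continuous|exact: continuous_cosM].
Qed.

Lemma integrable_block (g : R -> R) (k : int) : continuous g ->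
  mu.-integrable (block T @^-1` [set k]) (EFin \o g).
Proof.
move=> cg; rewrite block_fibre//; set x := T * _.
apply: (@integrableS _ _ _ mu `[x, x + T]%classic) => //.
  by move=> t /=; rewrite !in_itv/= => /andP[-> /ltW].
apply: continuous_compact_integrable; first exact: segment_compact.
exact: continuous_subspaceT.
Qed.

Lemma is_derive_sinM (w t : R) : w != 0 ->
  is_derive t 1 (fun t => w^-1 * sin (w * t)) (cos (w * t)).
Proof.
move=> w0.
have h1 : is_derive t 1 (fun t => w * t) w.
  by have := @is_deriveZ _ _ _ (@id R) w t 1 1 (is_derive_id t 1); rewrite /GRing.scale/= mulr1.
have h2 := is_derive1_comp (is_derive_sin (w * t)) h1.
have := is_deriveZ w^-1 h2.
by rewrite /GRing.scale/= mulrCA mulVf// mulr1.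
Qed.

Lemma Rintegral_block_cos (k n : int) : n != 0 ->
  \int[mu]_(t in block T @^-1` [set k]) cos (2 * pi * (n%:~R / T) * t) = 0.
Proof.
move=> n0; set w := 2 * pi * (n%:~R / T).
have w0 : w != 0.
  by rewrite !mulf_eq0 invr_eq0 intr_eq0 pnatr_eq0 (gt_eqF (pi_gt0 R)) (gt_eqF T0) (negbTE n0).
have := integrable_block k (@continuous_cosM w).
rewrite block_fibre//; set x := T * _ => ig.
rewrite Rintegral_itv_bndo_bndc//.
have xT : x < x + T by rewrite ltrDl.
rewrite /Rintegral (@continuous_FTC2 _ _ (fun t => w^-1 * sin (w * t)))//=.
- rewrite -mulrBr [w * (x + T)]mulrDr (_ : w * T = 2 * pi * n%:~R); last first.
    by rewrite /w !mulrA mulfVK ?gt_eqF.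
  have := congr1 (@complex.Im R) (expiD (w * x) (2 * pi * n%:~R)).
  by rewrite expi_period mulr1 /= => ->; rewrite subrr mulr0.
- by apply: continuous_subspaceT; exact: continuous_cosM.
- have cF : continuous (fun t : R => w^-1 * sin (w * t)).
    move=> t; apply/differentiable_continuous/derivable1_diffP.
    by have [] := is_derive_sinM t w0.
  split.
  + by move=> t _; have [] := is_derive_sinM t w0.
  + by apply: cvg_at_right_filter; exact: cF.
  + by apply: cvg_at_left_filter; exact: cF.
- by move=> t _; rewrite derive1E; have [_ ->] := is_derive_sinM t w0.
Qed.

(** Only the m diagonal terms j = l survive the integration over a period. *)
Lemma Rintegral_block_fejer (k : int) m : (0 < m)%N ->
  \int[mu]_(t in block T @^-1` [set k]) fejer m t = T.
Proof.
move=> m0; have mB := measurable_block_fibre T0 k.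
under eq_Rintegral do rewrite fejer_cosE.
have icos (n : int) := integrable_block k (@continuous_cosM (2 * pi * (n%:~R / T))).
have S (r : seq _) (g : 'I_m -> R -> R) :
   (forall i, mu.-integrable (block T @^-1` [set k]) (EFin \o g i)) ->
   mu.-integrable (block T @^-1` [set k]) (EFin \o (fun t => \sum_(i <- r) g i t)) /\
   \int[mu]_(t in block T @^-1` [set k]) (\sum_(i <- r) g i t) =
   \sum_(i <- r) \int[mu]_(t in block T @^-1` [set k]) g i t.
  move=> ig; split.
    rewrite (_ : _ \o _ = (fun t => \sum_(i <- r) (EFin \o g i) t)%E).
      exact: integrable_sum.
    by apply/funext => t /=; rewrite sumEFin.
  rewrite /Rintegral; under eq_integral do rewrite -sumEFin.
  rewrite integral_sum// -sum_fine//.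
  by move=> i _; apply: integrable_fin_num => //; exact: ig.
have S1 (j : 'I_m) := S (index_enum 'I_m) (fun l : 'I_m => fun t => cos (2 * pi * ((j%:Z - l%:Z)%:~R / T) * t)) (fun l => icos _).
have [S2 S3] := S (index_enum 'I_m) _ (fun j => (S1 j).1).
rewrite RintegralZl// S3.
rewrite (eq_bigr (fun=> T)).
  by rewrite sumr_const card_ord -[T *+ m]mulr_natl mulKf// pnatr_eq0 -lt0n.
move=> j _; rewrite (S1 j).2 (bigD1 j)//= big1 ?addr0.
  under eq_Rintegral do rewrite subrr mul0r mulr0 mul0r cos0.
  rewrite Rintegral_cst// mul1r block_fibre//; set x := T * _.
  have := @lebesgue_measure_itv R `[x, x + T[.
  by rewrite /= lte_fin ltrDl T0 -EFinD addrAC subrr add0r => ->.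
move=> l lj; apply: Rintegral_block_cos; rewrite subr_eq0.
by apply: contra lj => /eqP[] jl; apply/eqP/val_inj.
Qed.

End FejerKernel.

(** * Approximation by the Fejer kernel near a lattice point *)

Section FejerApproximation.
Context {R : realType}.
Variable T : R.
Hypothesis T0 : 0 < T.

Lemma fejer_le m t : fejer T m t <= m%:R :> R.
Proof.
case: m => [|m]; first by rewrite /fejer invr0 mulr0.
rewrite ler_pdivrMr ?ltr0n// -expr2 ler_pXn2r ?nnegrE ?normc_ge0//.
apply: le_trans (normc_sum _ _) _.
by under eq_bigr do rewrite normc_expi; rewrite sumr_const card_ord.
Qed.

Lemma cos_block (k : int) (t : R) :
  cos (2 * pi * (t / T)) = cos (2 * pi * (`|t - T * k%:~R| / T)).
Proof.
have -> : cos (2 * pi * (`|t - T * k%:~R| / T)) = cos (2 * pi * ((t - T * k%:~R) / T)).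
  have [h|h] := ger0P (t - T * k%:~R) => //.
  by rewrite mulNr mulrN cosN.
have -> : 2 * pi * (t / T) = 2 * pi * ((t - T * k%:~R) / T) + 2 * pi * k%:~R.
  by rewrite -mulrDr; congr (_ * _); rewrite mulrBl [T * _]mulrC mulfK ?gt_eqF// subrK.
have := congr1 (@complex.Re R) (expiD (2 * pi * ((t - T * k%:~R) / T)) (2 * pi * k%:~R)).
by rewrite expi_period mulr1.
Qed.

Lemma block_dist k t : block T t = k -> `|t - T * k%:~R| <= T / 2.
Proof.
move=> tk; have : (block T @^-1` [set k]) t by [].
rewrite block_fibre//= in_itv/= => /andP[h1 h2].
by rewrite ler_norml; apply/andP; split; lra.
Qed.

(** Close to the lattice point, a is almost constant by continuity; farther away, but
still within the block, the kernel is O(1/m).  The two alternatives are merged into one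
bound that is easy to integrate. *)
Lemma fejer_block_approx (a : R -> R) (B : R) (k : int) (e : R) :
  continuous a -> (forall t, `|a t| <= B) -> 0 < e ->
  exists M, forall m, (M <= m)%N -> (0 < m)%N -> forall t, block T t = k ->
    `|a t - a (T * k%:~R)| * fejer T m t <= e * fejer T m t + e.
Proof.
move=> ca aB e0; have B0 : 0 <= B by apply: le_trans (aB 0).
have /cvgrPdist_lt/(_ _ e0) [d /= d0 hd] := ca (T * k%:~R).
(* Within a block the angle 2 pi |t - T k| / T stays in [0, pi], where cosine decreases;
   the minimum with T/2 keeps the threshold angle in that range as well. *)
pose d' := Num.min d (T / 2).
have d'0 : 0 < d' by rewrite lt_min d0 divr_gt0.
have d'T : d' <= T / 2 by rewrite ge_min lexx orbT.
pose eta := 2 - 2 * cos (2 * pi * (d' / T)).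
have pi0 := pi_gt0 R.
have angle_ge0 x : 0 <= x -> 0 <= 2 * pi * (x / T).
  by move=> x0; rewrite !mulr_ge0 ?invr_ge0 ?(ltW pi0) ?(ltW T0).
have angle_le x : x <= T / 2 -> 2 * pi * (x / T) <= pi.
  move=> xT; rewrite -[leRHS]mulr1 [2 * pi]mulrC -mulrA ler_pM2l// mulrA ler_pdivrMr//.
  by rewrite mul1r; lra.
have eta0 : 0 < eta.
  rewrite subr_gt0 -[ltRHS]mulr1 ltr_pM2l//.
  rewrite -[ltRHS](cos0 R) ltr_cos ?in_itv/= ?lexx ?(ltW pi0) ?angle_ge0 ?angle_le ?(ltW d'0)//.
  by rewrite !mulr_gt0 ?invr_gt0.
pose M := 8 * B / (eta * e).
exists (`|Num.floor M|.+1)%N => m mM m0 t tk.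
have [tnear|tfar] := ltP `|t - T * k%:~R| d'.
  rewrite (@le_trans _ _ (e * fejer T m t))//; last by rewrite lerDl ltW.
  rewrite ler_wpM2r ?fejer_ge0// distrC ltW//.
  by apply: hd => /=; rewrite distrC; move: tnear; rewrite lt_min => /andP[].
rewrite (@le_trans _ _ e)//; last by rewrite lerDr mulr_ge0 ?fejer_ge0 ?ltW.
have tT := block_dist tk.
have cle : cos (2 * pi * (t / T)) <= cos (2 * pi * (d' / T)).
  rewrite (cos_block k) leNgt ltr_cos ?in_itv/= ?angle_ge0 ?angle_le ?(ltW d'0)// -leNgt.
  by rewrite ler_pM2l ?mulr_gt0// ler_pM2r ?invr_gt0.
have fe : fejer T m t * eta <= 4 / m%:R.
  apply: le_trans (fejer_decay T t m0); rewrite ler_wpM2l ?fejer_ge0// /eta; lra.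
have mR : (0 : R) < m%:R by rewrite ltr0n.
have Mm : M <= m%:R.
  rewrite ltW//; apply: lt_le_trans (floorD1_gt M) _.
  have M0 : 0 <= Num.floor M.
    rewrite floor_ge0; apply: divr_ge0; first exact: mulr_ge0.
    by rewrite ltW// mulr_gt0.
  rewrite -[m%:R]/(m%:Z%:~R) ler_int; move: (Num.floor M) mM M0 => -[] // n nm _.
  by rewrite -[n%:Z + 1]/((n + 1)%N%:Z) addn1 lez_nat.
have aa : `|a t - a (T * k%:~R)| <= 2 * B.
  by rewrite (le_trans (ler_normB _ _))// mulr_natl mulr2n lerD.
apply: (@le_trans _ _ (2 * B * (4 / m%:R / eta))).
  by apply: ler_pM; rewrite ?fejer_ge0// ler_pdivlMr.
rewrite (_ : 2 * B * (4 / m%:R / eta) = (8 * B) / eta / m%:R); last by field; rewrite !gt_eqF.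
rewrite ler_pdivrMr//; move: Mm; rewrite /M ler_pdivrMr ?mulr_gt0// => h.
by rewrite ler_pdivrMr//; apply: le_trans h _; rewrite le_eqVlt; apply/orP; left; apply/eqP; ring.
Qed.

Lemma eventually_all (s : seq int) (P : int -> nat -> Prop) :
  (forall k, exists M, forall m, (M <= m)%N -> P k m) ->
  exists M, forall m, (M <= m)%N -> forall k, k \in s -> P k m.
Proof.
move=> h; elim: s => [|k s [M IH]]; first by exists 0%N.
have [N hN] := h k; exists (maxn M N) => m; rewrite geq_max => /andP[Mm Nm] l.
by rewrite inE => /predU1P[->|ls]; [exact: hN|exact: IH].
Qed.

End FejerApproximation.

(** * Poisson summation, real case *)

Section Poisson.
Context {R : realType}.
Notation mu := (@lebesgue_measure R).
Variable T : R.
Hypothesis T0 : 0 < T.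

Lemma integrable_fejerM (a : R -> R) (c : int -> \bar R) m : continuous a -> nnsummable c ->
  (forall t, (`|a t|%:E <= c (Num.floor t))%E) ->
  mu.-integrable setT (EFin \o (fun t => a t * fejer T m t)).
Proof.
move=> ca sc ac; apply: (real_integrable_le_cells (c := fun n => (m%:R%:E * c n)%E) _ _ _).1.
- by move=> t; apply: cvgM; [exact: ca|exact: continuous_fejer].
- exact: nnsummableZ.
- move=> t; rewrite normrM mulrC EFinM; apply: lee_pmul => //.
  by rewrite lee_fin ger0_norm ?fejer_ge0 ?fejer_le.
Qed.

Lemma nnsummable_le_total (c : int -> \bar R) (n : int) : nnsummable c ->
  (c n <= (fine (\esum_(n in [set: int]) c n))%:E)%E.
Proof.
move=> [c0 cfin]; rewrite fineK ?ge0_fin_numE ?esum_ge0//.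
by rewrite -(esum_set1 (t := n))//; exact: esum_subset.
Qed.

Let B k := block T @^-1` [set k].

Lemma integrable_block_restrict (g : R -> R) k : continuous g ->
  mu.-integrable setT (EFin \o (g \_ (B k))).
Proof.
move=> cg; rewrite -restrict_EFin.
have [+ _] := integrable_mkcond (mu := mu) (EFin \o g) (measurable_block_fibre T0 k).
by apply; exact: integrable_block.
Qed.

Lemma lebesgue_block k : mu (B k) = T%:E.
Proof.
rewrite /B block_fibre//; set x := T * _.
apply: etrans (lebesgue_measure_itv _) _.
by rewrite /= lte_fin ltrDl T0 -EFinD addrAC subrr add0r.
Qed.

Lemma integral_block_fejer k m (x y : R) : (0 < m)%N -> 0 <= x -> 0 <= y ->
  (\int[mu]_(t in B k) (x * fejer T m t + y)%:E = ((x + y) * T)%:E)%E.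
Proof.
move=> m0 x0 y0.
have mB : measurable (B k : set (measurableTypeR R)) := measurable_block_fibre T0 k.
have ic : mu.-integrable (B k) (EFin \o (fun t => x * fejer T m t + y)).
  apply: integrable_block => // t; apply: cvgD; last exact: cvg_cst.
  by apply: cvgM; [exact: cvg_cst|exact: continuous_fejer].
have if_ : mu.-integrable (B k) (EFin \o fejer T m).
  by apply: integrable_block => //; exact: continuous_fejer.
rewrite -(fineK (integrable_fin_num mB ic)); congr EFin.
rewrite -[LHS]/(\int[mu]_(t in B k) (x * fejer T m t + y)) RintegralD//; last 2 first.
- exact: (integrableZl mB x if_).
- apply: (@integrable_block R T T0 (fun=> y) k) => t; exact: cvg_cst.
rewrite RintegralZl// Rintegral_block_fejer// Rintegral_cst//.
by rewrite [X in y * fine X](_ : _ = T%:E) ?mulrDl//; exact: lebesgue_block.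
Qed.

(** On the block of k in F the function a is compared with the constant a(T k), whose
integral against the kernel is T a(T k); on the other blocks the kernel has mean 1
and a is at most the block weight b k, so that they contribute at most T times a
tail of b, uniformly in m. *)
Lemma fejer_poisson_real (a : R -> R) (c : int -> \bar R) : continuous a -> nnsummable c ->
  (forall t, (`|a t|%:E <= c (Num.floor t))%E) -> forall e : R, 0 < e ->
  exists F0 : {fset int}, forall F : {fset int}, (F0 `<=` F)%fset ->
  exists M, forall m, (M <= m)%N -> (0 < m)%N ->
  `|\int[mu]_t (a t * fejer T m t) - T * \sum_(k <- F) a (T * k%:~R)| <= e.
Proof.
move=> ca sc ac e e0.
have [b sb cb] := block_majorant T0 sc.
have e20 : 0 < e / (2 * T) by rewrite divr_gt0// mulr_gt0.
have [F0 hF0] := tail_small sb.1 sb.2 e20.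
exists F0 => F /hF0 tailF.
pose N := (#|` F|)%fset.
(* The N blocks of F contribute 2 e1 T each, at most e/2 in total; N + 1 avoids a
   division by zero when F is empty. *)
pose e1 := e / (4 * T * N.+1%:R).
have e10 : 0 < e1 by rewrite divr_gt0// !mulr_gt0.
pose Bd := fine (\esum_(n in [set: int]) c n).
have aB t : `|a t| <= Bd.
  by rewrite -lee_fin (le_trans (ac t))// nnsummable_le_total.
have [M hM] := @eventually_all F _ (fun k =>
   let: ex_intro M hM := fejer_block_approx T0 k ca aB e10 in ex_intro _ M hM).
exists M => m /hM {}hM m0.
have {}hM k : k \in F -> forall t, block T t = k ->
   `|a t - a (T * k%:~R)| * fejer T m t <= e1 * fejer T m t + e1.
  by move=> kF; exact: hM.
have cfe : continuous (fejer T m : R -> R) := @continuous_fejer R T m.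
pose q k t := a (T * k%:~R) * ((fejer T m) \_ (B k)) t.
have iq k : mu.-integrable setT (EFin \o q k).
  have := integrableZl measurableT (a (T * k%:~R)) (integrable_block_restrict k cfe).
  exact.
have intq k : \int[mu]_t q k t = a (T * k%:~R) * T.
  rewrite RintegralZl//; last exact: integrable_block_restrict.
  by rewrite -Rintegral_mkcond Rintegral_block_fejer.
have iaf := integrable_fejerM m ca sc ac.
have isq : mu.-integrable setT (EFin \o (fun t => \sum_(k <- F) q k t)).
  rewrite (_ : _ \o _ = (fun t => \sum_(k <- F) (EFin \o q k) t)%E).
    by apply: integrable_sum => // k _; exact: iq.
  by apply/funext => t /=; rewrite sumEFin.
have intsq : \int[mu]_t (\sum_(k <- F) q k t) = T * \sum_(k <- F) a (T * k%:~R).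
  rewrite /Rintegral; under eq_integral do rewrite -sumEFin.
  rewrite integral_sum// -sum_fine//.
    by rewrite mulr_sumr; apply: eq_bigr => k _; rewrite mulrC -intq.
  by move=> i _; apply: integrable_fin_num => //; exact: iq.
pose d t := a t * fejer T m t - \sum_(k <- F) q k t.
have id_ : mu.-integrable setT (EFin \o d).
  have := integrableB measurableT iaf isq; exact.
rewrite -intsq -RintegralB// -lee_fin.
apply: (@le_trans _ _ (\int[mu]_t `|d t|%:E)%E).
  by rewrite EFin_normr_Rintegral//; exact: le_abse_integral (measurable_int _ id_).
have mab : measurable_fun setT (fun t => `|d t|%:E).
  by apply/measurable_EFinP/measurableT_comp => //; apply/measurable_EFinP; exact: measurable_int id_.
rewrite (@ge0_integral_fibre _ _ R mu int (block T) (fun t => `|d t|%:E))//; last first.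
  exact: measurable_block_fibre.
pose beta k := if k \in F then ((e1 + e1) * T)%:E else (T%:E * b k)%E.
have db k : (\int[mu]_(t in B k) `|d t|%:E <= beta k)%E.
  rewrite /beta; have mB : measurable (B k : set (measurableTypeR R)) := measurable_block_fibre T0 k.
  case: ifPn => kF.
    rewrite -(integral_block_fejer k m0 (ltW e10) (ltW e10)).
    apply: ge0_le_integral => //; first exact: measurable_funTS.
      apply/measurable_EFinP; apply: measurable_funTS; apply: continuous_measurable_fun => t.
      by apply: cvgD; [apply: cvgM; [exact: cvg_cst|exact: cfe]|exact: cvg_cst].
    move=> t /= tk; rewrite lee_fin; apply: le_trans (hM k kF t tk).
    rewrite /d (big_fsetD1 k)//= big_seq big1 ?addr0; last first.
      move=> l; rewrite !inE => /andP[lk _]; rewrite /q patchE memNset ?mulr0//.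
      by rewrite /B/= tk; apply/eqP; rewrite eq_sym.
    by rewrite /q patchE mem_set//= -mulrBl normrM (ger0_norm (fejer_ge0 _ _ _)).
  have bfin : b k \is a fin_num by rewrite ge0_fin_numE ?sb.1 ?(nnsummable_lty _ sb).
  have b0 : 0 <= fine (b k) by rewrite fine_ge0 ?sb.1.
  rewrite -(fineK bfin) -EFinM mulrC -[_ * T]/((fine (b k)) * T) -[fine (b k)]addr0.
  rewrite -(integral_block_fejer k m0 b0 (lexx 0)).
  apply: ge0_le_integral => //; first exact: measurable_funTS.
    apply/measurable_EFinP; apply: measurable_funTS; apply: continuous_measurable_fun => t.
    by apply: cvgD; [apply: cvgM; [exact: cvg_cst|exact: cfe]|exact: cvg_cst].
  move=> t /= tk; rewrite addr0 lee_fin /d big_seq big1 ?subr0; last first.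
    move=> l lF; rewrite /q patchE memNset ?mulr0//.
    by rewrite /B/= tk => kl; move: kF; rewrite kl lF.
  rewrite normrM (ger0_norm (fejer_ge0 _ _ _)) ler_wpM2r ?fejer_ge0//.
  by rewrite -lee_fin fineK// -tk; apply: le_trans (ac t) (cb t).
apply: le_trans (le_esum (fun k _ => db k)) _.
have beta0 k : (0 <= beta k)%E.
  by apply: le_trans (db k); exact: integral_ge0.
rewrite (sum_tail F)//.
have -> : (\sum_(k <- F) beta k = (N%:R * ((e1 + e1) * T))%:E)%E.
  rewrite big_seq (eq_bigr (fun=> ((e1 + e1) * T)%:E)); last by move=> k kF; rewrite /beta kF.
  rewrite -big_seq sumEFin; congr EFin.
  by rewrite big_const_seq count_predT iter_addr_0 mulr_natl.
have -> : tail beta F = (T%:E * tail b F)%E.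
  rewrite /tail -esumZl ?ltW//; last exact: sb.1.
  by apply: eq_esum => k /= /negP kF; rewrite /beta (negbTE kF).
have tfin : tail b F \is a fin_num.
  rewrite ge0_fin_numE ?tail_ge0//; last exact: sb.1.
  exact: lt_trans tailF (ltry _).
move: tailF; rewrite -(fineK tfin) lte_fin -EFinM -EFinD lee_fin.
rewrite ltr_pdivlMr ?mulr_gt0// => tF.
have : N%:R * ((e1 + e1) * T) <= e / 2.
  rewrite /e1 (_ : _ * _ = (e / 2) * (N%:R / N.+1%:R)).
    by rewrite ler_piMr ?divr_ge0 ?ltW// ltr_pdivrMr// mul1r ltr_nat.
  by field; rewrite !gt_eqF// ltr0n.
by lra.
Qed.

End Poisson.

(** * Poisson summation and its consequences *)

Section PoissonComplex.
Context {R : realType}.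
Implicit Types phi : R -> R[i].

Lemma amalgam_fourier phi (s : R) : amalgam phi ->
  amalgam (fun t => phi t * expi (- (2 * pi * s * t))).
Proof.
move=> /(amalgam_expi (- (2 * pi * s))) h.
by under eq_fun do rewrite mulrC -mulNr.
Qed.

(** The Fejer mean at 0 of the Fourier series with coefficients \hat phi(n/T), written
as a double sum over j and l with n = j - l. *)
Definition fejer_mean (T : R) (m : nat) phi : R[i] := (m%:R^-1)%:C *
  \sum_(j < m) \sum_(l < m) fourier phi ((j%:R - l%:R) / T).

Lemma fejer_meanE (T : R) m phi : amalgam phi ->
  fejer_mean T m phi = cintegral (fun t => phi t * (fejer T m t)%:C).
Proof.
move=> ap.
have I s := amalgam_integrable (amalgam_fourier s ap).
rewrite (_ : (fun t => _) = (fun t => (m%:R^-1)%:C * \sum_(j < m) \sum_(l < m)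
  (phi t * expi (- (2 * pi * ((j%:R - l%:R) / T) * t))))); last first.
  apply/funext => t; rewrite fejerE mulrCA; congr (_ * _).
  by rewrite mulr_sumr; apply: eq_bigr => j _; rewrite mulr_sumr.
have I2 (j : 'I_m) : cintegrable (fun t => \sum_(l < m)
    (phi t * expi (- (2 * pi * ((j%:R - l%:R) / T) * t)))).
  exact: cintegrable_sum.
rewrite cintegralZ; last exact: cintegrable_sum.
congr (_ * _); rewrite cintegral_sum//; apply: eq_bigr => j _.
by rewrite cintegral_sum.
Qed.

Lemma fejer_poisson (T : R) phi : 0 < T -> amalgam phi -> forall e : R, 0 < e ->
  exists F0 : {fset int}, forall F : {fset int}, (F0 `<=` F)%fset ->
  exists M, forall m, (M <= m)%N -> (0 < m)%N ->
  normc (fejer_mean T m phi - T%:C * \sum_(k <- F) phi (T * k%:~R)) <= e.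
Proof.
move=> T0 ap e e0; have [/continuous_ReIm[cR cI] [c sc fc]] := ap.
have hR t : (`|complex.Re (phi t)|%:E <= c (Num.floor t))%E.
  by apply: le_trans (fc t); rewrite lee_fin normc_Re.
have hI t : (`|complex.Im (phi t)|%:E <= c (Num.floor t))%E.
  by apply: le_trans (fc t); rewrite lee_fin normc_Im.
have e20 : 0 < e / 2 by rewrite divr_gt0.
have [F1 h1] := fejer_poisson_real T0 cR sc hR e20.
have [F2 h2] := fejer_poisson_real T0 cI sc hI e20.
exists (F1 `|` F2)%fset => F; rewrite fsubUset => /andP[/h1[M1 {}h1] /h2[M2 {}h2]].
exists (maxn M1 M2) => m; rewrite geq_max => /andP[/h1 {}h1 /h2 {}h2] m0.
rewrite (le_trans (normc_le_ReIm _))// [e]splitr fejer_meanE// ReB ImB ReM ImM /=.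
rewrite !mul0r subr0 addr0.
have -> : complex.Re (\sum_(k <- F) phi (T * k%:~R)) = \sum_(k <- F) complex.Re (phi (T * k%:~R)).
  exact: (raddf_sum (@complex.Re R : Rcomplex R -> R)).
have -> : complex.Im (\sum_(k <- F) phi (T * k%:~R)) = \sum_(k <- F) complex.Im (phi (T * k%:~R)).
  exact: (raddf_sum (@complex.Im R : Rcomplex R -> R)).
apply: lerD.
  apply: le_trans (h1 m0); rewrite le_eqVlt; apply/orP; left; apply/eqP; congr (`|_ - _|).
  by apply: eq_Rintegral => t _; rewrite ReM /= mulr0 subr0.
apply: le_trans (h2 m0); rewrite le_eqVlt; apply/orP; left; apply/eqP; congr (`|_ - _|).
by apply: eq_Rintegral => t _; rewrite ImM /= mulr0 add0r.
Qed.

Lemma sum_fset_sub (V : zmodType) (J : choiceType) (F G : {fset J}) (a : J -> V) :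
  (F `<=` G)%fset -> \sum_(k <- G) a k = \sum_(k <- F) a k + \sum_(k <- (G `\` F)%fset) a k.
Proof.
move=> FG; rewrite (big_fsetID _ (mem F))/=; congr (_ + _).
  by congr bigop; congr (enum_fset _); apply/fsetP => x; rewrite !inE /= andbC; case: (boolP (x \in F)) => // /(fsubsetP FG).
by congr bigop; congr (enum_fset _); apply/fsetP => x; rewrite !inE /= andbC.
Qed.

Lemma normc_sum_tail (J : choiceType) (F G : {fset J}) (a : J -> R[i]) :
  ((normc (\sum_(k <- (G `\` F)%fset) a k))%:E <= tail (fun k => (normc (a k))%:E) F)%E.
Proof.
apply: (@le_trans _ _ (\sum_(k <- (G `\` F)%fset) (normc (a k))%:E)%E).
  by rewrite sumEFin lee_fin normc_sum.
have a0 k : (0 <= (normc (a k))%:E)%E by rewrite lee_fin normc_ge0.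
rewrite -esum_fsetE//; apply: esum_subset => // k /=.
by rewrite !inE => /andP[/negP].
Qed.

(** The Fejer means converge to T sum_k phi(T k) by [fejer_poisson], so a bound valid for
all of them passes to the limit; the limit is replaced by a finite partial sum and a
tail in order to avoid infinite sums of complex numbers. *)
Lemma poisson_ineq (T : R) phi (z : R[i]) (A : R) : 0 < T -> amalgam phi ->
  (forall m, (0 < m)%N -> normc (fejer_mean T m phi - z) <= A) ->
  forall F : {fset int}, ((normc (z - T%:C * \sum_(k <- F) phi (T * k%:~R)))%:E <=
    A%:E + T%:E * tail (fun k => (normc (phi (T * k%:~R)))%:E) F)%E.
Proof.
move=> T0 ap hA F; apply/lee_addgt0Pr => e e0.
have [F0 /(_ (F0 `|` F)%fset (fsubsetUl _ _)) [M /(_ M.+1 (leqnSn _) isT)]] := fejer_poisson T0 ap e0.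
have {hA} := hA M.+1 isT; set f := fejer_mean _ _ _ => hA.
rewrite (sum_fset_sub _ (fsubsetUr F0 F)) mulrDr => h.
have := normc_sum_tail F (F0 `|` F)%fset (fun k => phi (T * k%:~R)).
set x := \sum_(k <- F) _ in h *; set y := \sum_(k <- _) _ in h * => hy.
apply: (@le_trans _ _ ((A + T * normc y + e)%:E)).
  rewrite lee_fin.
  have -> : z - T%:C * x = (- (f - z) + T%:C * y) + (f - (T%:C * x + T%:C * y)) by ring.
  rewrite (le_trans (le_normcD _ _))// lerD//.
  rewrite (le_trans (le_normcD _ _))// normcN lerD//.
  by rewrite normcM normc_real gtr0_norm.
rewrite !EFinD leeD2r// leeD2l// EFinM lee_wpmul2l// lee_fin ltW//.
Qed.

Lemma floor_divz (x : int) (n : nat) : (0 < n)%N ->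
  Num.floor (x%:~R / n%:R : R) = (x %/ n)%Z.
Proof.
move=> n0; apply/eqP; rewrite floor_eq ler_pdivlMr ?ltr0n// ltr_pdivrMr ?ltr0n//.
rewrite -[n%:R]/(n%:Z%:~R) -!intrM ler_int ltr_int.
have nz : n%:Z != 0 by lia.
have := divz_eq x n; have := modz_ge0 x nz; have := ltz_pmod x (n0 : 0 < n%:Z).
by lia.
Qed.

(** For fixed j, the points (j - l)/n, l < m, fall at most n times into each unit cell. *)
Lemma fejer_mean_le (n m : nat) phi (d : int -> \bar R) : (0 < n)%N -> (0 < m)%N ->
  nnsummable d -> celldom d (fourier phi) ->
  ((normc (fejer_mean n%:R m phi))%:E <= n%:R%:E * \esum_(k in [set: int]) d k)%E.
Proof.
move=> n0 m0 sd hd; have [d0 _] := sd.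
have nz : n%:Z != 0 by lia.
have key (j : 'I_m) : (\sum_(l < m) (normc (fourier phi ((j%:R - l%:R) / n%:R)))%:E <=
    n%:R%:E * \esum_(k in [set: int]) d k)%E.
  apply: (@le_trans _ _ (\sum_(l < m) d ((j%:Z - l%:Z) %/ n)%Z)%E).
    apply: lee_sum => l _; apply: le_trans (hd _) _.
    by rewrite -[j%:R]/(j%:Z%:~R) -[l%:R]/(l%:Z%:~R) -intrB floor_divz.
  rewrite (fsbig_ord _ m (fun l : nat => d ((j%:Z - l%:Z) %/ n)%Z)) -esum_fset//.
  apply: (@esum_le_fibre _ _ _ n _ (fun l : nat => ((j%:Z - l%:Z) %/ n)%Z)
    (fun l : nat => absz ((j%:Z - l%:Z) %% n)%Z)) => //.
    by move=> l _; have := ltz_pmod (j%:Z - l%:Z) (n0 : 0 < n%:Z); have := modz_ge0 (j%:Z - l%:Z) nz; lia.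
  move=> l k _ _ e1 e2.
  have := divz_eq (j%:Z - l%:Z) n; have := divz_eq (j%:Z - k%:Z) n; rewrite e1.
  have := modz_ge0 (j%:Z - l%:Z) nz; have := modz_ge0 (j%:Z - k%:Z) nz.
  by lia.
have dfin : \esum_(k in [set: int]) d k \is a fin_num by rewrite ge0_fin_numE ?esum_ge0 ?sd.2.
rewrite /fejer_mean normcM normc_real ger0_norm ?invr_ge0// -(fineK dfin) -EFinM lee_fin.
rewrite mulrC ler_pdivrMr ?ltr0n//.
apply: le_trans (normc_sum _ _) _.
rewrite [leRHS]mulr_natr -[in leRHS](card_ord m) -sumr_const; apply: ler_sum => j _.
apply: le_trans (normc_sum _ _) _.
by have := key j; rewrite -(fineK dfin) -EFinM sumEFin lee_fin.
Qed.

(** Poisson summation on n Z with F = {0}: the Fourier side is at most n times the sum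
of d, and |phi(n k)| summed over k != 0 is arbitrarily small for n large.  This
stands in for |phi(0)| <= int |\hat phi|, hence for Fourier inversion. *)
Lemma normc_le_fourier0 phi (d : int -> \bar R) : amalgam phi -> nnsummable d -> celldom d (fourier phi) ->
  ((normc (phi 0))%:E <= \esum_(k in [set: int]) d k)%E.
Proof.
move=> ap sd hd; have [_ [c sc fc]] := ap.
apply/lee_addgt0Pr => e e0.
have [F0 /(_ F0 (fsubset_refl _)) tl] := tail_small sc.1 sc.2 e0.
(* n exceeds every index in F0, so no nonzero multiple of n is in F0. *)
pose n := (\sum_(k <- F0) `|k|).+1%N.
have nF k : k \in F0 -> (`|k| < n)%N.
  by move=> kF; rewrite ltnS (big_fsetD1 k)//= leq_addr.
have n0 : (0 < n)%N by [].
have nR : (0 : R) < n%:R by rewrite ltr0n.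
have dfin : \esum_(k in [set: int]) d k \is a fin_num.
  by have [d0 dfin] := sd; rewrite ge0_fin_numE ?esum_ge0.
have hm m : (0 < m)%N -> normc (fejer_mean n%:R m phi - 0) <= n%:R * fine (\esum_(k in [set: int]) d k).
  by move=> m0; rewrite subr0 -lee_fin EFinM fineK//; exact: fejer_mean_le.
have := poisson_ineq nR ap hm [fset 0]%fset.
rewrite big_seq_fset1 mulr0 sub0r normcN normcM normc_real gtr0_norm// !EFinM fineK// -muleDr//; last first.
  by rewrite fin_num_adde_defr.
rewrite lee_pmul2l// ?lte_fin// => /le_trans; apply; rewrite leeD2l//.
apply: le_trans (ltW tl).
apply: (@le_trans _ _ (\esum_(k in ~` [set` [fset 0%R]%fset]) c (n%:Z * k)%R)%E).
  apply: le_esum => k _; apply: le_trans (fc _) _.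
  by rewrite -[n%:R]/(n%:Z%:~R) -intrM intrKfloor.
rewrite -(@esum_image R _ _ _ (fun k : int => n%:Z * k)%R c); last first.
  by move=> j k _ _; apply: mulfI.
apply: esum_subset; first exact: sc.1.
move=> _ [k /= k0 <-] /nF; apply/negP; rewrite -leqNgt abszM absz_nat leq_pmulr//.
by rewrite absz_gt0; apply/eqP => kz; apply: k0; rewrite kz inE.
Qed.

Lemma fourier_translate phi (u s : R) : amalgam phi ->
  fourier (fun t => phi (t + u)) s = expi (2 * pi * s * u) * fourier phi s.
Proof.
move=> ap; rewrite /fourier -[in RHS](@cintegral_translate R (fun t => phi t * expi (- (2 * pi * s * t))) u); last first.
  exact: amalgam_integrable (amalgam_fourier s ap).
rewrite -cintegralZ; last first.
  exact: amalgam_integrable (amalgam_translate u (amalgam_fourier s ap)).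
congr cintegral; apply/funext => t; rewrite mulrCA -expiD; congr (_ * expi _); ring.
Qed.

Lemma normc_le_fourier phi (d : int -> \bar R) t : amalgam phi -> nnsummable d -> celldom d (fourier phi) ->
  ((normc (phi t))%:E <= \esum_(k in [set: int]) d k)%E.
Proof.
move=> ap sd hd.
have := @normc_le_fourier0 (fun u => phi (u + t)) d (amalgam_translate t ap) sd.
rewrite add0r; apply => s; rewrite fourier_translate// normcM normc_expi mul1r.
exact: hd.
Qed.

End PoissonComplex.

(** * Gaussian windows and the short-time Fourier transform *)

Section Gauss.
Context {R : realType}.

Lemma nnsummable_geometric (q : R) : 0 <= q < 1 -> nnsummable (fun n : int => (q ^+ `|n|%N)%:E).
Proof.
move=> /andP[q0 q1]; split; first by move=> n; rewrite lee_fin exprn_ge0.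
have p0 (n : nat) : (0 <= (q ^+ n)%:E)%E by rewrite lee_fin exprn_ge0.
have le2 : (\esum_(n in [set: int]) (q ^+ `|n|%N)%:E <=
    2%:R%:E * \esum_(n in [set: nat]) (q ^+ n)%:E)%E.
  apply: (@esum_le_fibre R int nat 2 setT absz (fun n => (n < 0)%R : nat)
     (fun n => (q ^+ n)%:E) p0).
  - by move=> n _; case: (n < 0)%R.
  - by move=> m n _ _; lia.
apply: le_lt_trans le2 _.
rewrite -nneseries_esumT//.
have le : (\sum_(0 <= i <oo) (q ^+ i)%:E <= ((1 - q)^-1)%:E)%E.
  apply: lime_le; first exact: is_cvg_nneseries.
  apply: nearW => n; rewrite sumEFin lee_fin big_mkord.
  rewrite -[leRHS]mul1r ler_pdivlMr ?subr_gt0// mulrC -[_ * _]opprK -mulNr opprB -subrX1.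
  by rewrite opprB lerBlDr lerDl exprn_ge0.
apply: le_lt_trans (lee_wpmul2l _ le) _; first by rewrite lee_fin.
by rewrite -EFinM ltry.
Qed.

(** From (|t| - 1/2)^2 >= 0 and pi >= 2 one gets pi t^2 >= |t| - 1, so the
Gaussian decays at least geometrically from cell to cell. *)
Lemma celldom_gauss : exists2 c : int -> \bar R, nnsummable c & celldom c (@gauss R).
Proof.
exists (fun n => (expR 2)%:E * (expR (-1) ^+ `|n|%N)%:E)%E.
  apply: nnsummableZ; first exact: expR_ge0.
  by apply: nnsummable_geometric; rewrite expR_ge0/= expR_lt1; lra.
move=> t; rewrite -EFinM lee_fin normc_real ger0_norm ?expR_ge0//.
rewrite -expRM_natr -expRD ler_expR.
have h : (`|Num.floor t|%N%:R : R) <= `|t| + 1.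
  have := floor_le t; have := floorD1_gt t; rewrite intrD.
  case: (Num.floor t) => n h1 h2.
    rewrite absz_nat; have := ler_norm t; move: h1 h2; rewrite -[n%:~R]/(n%:R); lra.
  rewrite NegzE abszN absz_nat; have := ler_norm (- t); rewrite normrN.
  by move: h1 h2; rewrite NegzE mulrNz -[n.+1%:~R]/(n.+1%:R); lra.
rewrite mulN1r.
have : t ^+ 2 <= pi * t ^+ 2.
  by rewrite ler_peMl ?sqr_ge0//; apply: le_trans (pi_ge2 R); lra.
have : 0 <= (`|t| - 1 / 2) ^+ 2 by exact: sqr_ge0.
have -> : t ^+ 2 = `|t| ^+ 2 by rewrite real_normK ?num_real.
by rewrite sqrrB expr2 /=; lra.
Qed.

Lemma continuous_gauss : continuous (@gauss R : R -> R[i]^o).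
Proof.
apply/continuous_ReIm; split => t /=; last exact: cvg_cst.
apply: (@continuous_comp R R R (fun t : R => - (pi * t ^+ 2)) (@expR R) t); last exact: continuous_expR.
by apply: cvgN; apply: cvgM; [exact: cvg_cst|apply: (@cvgM _ R); exact: cvg_id].
Qed.

(** The short-time Fourier transform of h at time x is the Fourier transform of this
function. *)
Definition window (h : R -> R[i]) (x t : R) : R[i] := h t * (gauss (t - x))^*.

Lemma windowE h x t : window h x t = h t * gauss (t - x).
Proof. by rewrite /window; congr (_ * _); exact: conjc_real. Qed.

Lemma stft_fourier h z : stft h z = fourier (window h z.1) z.2.
Proof. by []. Qed.

Lemma amalgam_window h (M : R) x : continuous (h : R -> R[i]^o) ->
  (forall t, normc (h t) <= M) -> amalgam (window h x).
Proof.
move=> ch hM.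
rewrite (_ : window h x = fun t => h t * gauss (t - x)); last first.
  by apply/funext => t; exact: windowE.
apply: amalgamM ch hM _; apply: (@amalgam_translate R _ (- x)); split; first exact: continuous_gauss.
exact: celldom_gauss.
Qed.

Lemma Cb_bound (T : topologicalType) (h : T -> R[i]) : Cb h -> exists M, forall t, normc (h t) <= M.
Proof.
move=> [_ hfin].
exists (fine (supnorm h)) => t; rewrite -lee_fin; apply: le_trans (supnorm_ge h t) _.
rewrite fineK// ge0_fin_numE//; apply: le_trans (supnorm_ge h t).
by rewrite lee_fin normc_ge0.
Qed.

(** The constant is uniform in time because translating the Gaussian at most doubles the
sum of its cell bounds. *)
Lemma stft_bound : exists2 C : R, 0 <= C & forall (h : R -> R[i]) (M : R), continuous (h : R -> R[i]^o) ->
  (forall t, normc (h t) <= M) -> forall z, normc (stft h z) <= C * M.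
Proof.
have [c sc gc] := celldom_gauss.
have cfin : \esum_(k in [set: int]) c k \is a fin_num.
  by have [c0 cf] := sc; rewrite ge0_fin_numE ?esum_ge0.
exists (2%:R * (2%:R * fine (\esum_(k in [set: int]) c k))).
  by rewrite !mulr_ge0// fine_ge0// esum_ge0// => k _; exact: sc.1.
move=> h M ch hM z; have M0 : 0 <= M by apply: le_trans (hM 0); exact: normc_ge0.
have [cw _] := amalgam_window z.1 ch hM.
pose b n := (M%:E * shift_weight +%R (Num.floor (- z.1)) c n)%E.
have sb : nnsummable b by apply: nnsummableZ => //; exact: nnsummable_shift_weight sc addz_inj.
rewrite -lee_fin stft_fourier /fourier.
apply: (le_trans (@cintegral_le R _ b _ sb _)).
- by under eq_fun do rewrite -mulNr; apply: continuous_mulc cw (@continuous_expi R _).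
- move=> t; rewrite normcM normc_expi mulr1 windowE.
  exact: (celldomM (celldom_translate (- z.1) sc.1 gc) hM t).
rewrite esumZl//; last by apply: shift_weight_ge0 => n; exact: sc.1.
rewrite muleCA EFinM muleC; apply: lee_wpmul2r; first by rewrite lee_fin.
rewrite !EFinM fineK//; apply: lee_wpmul2l; first by rewrite lee_fin.
apply: esum_shift_weight; [exact: sc.1|exact: addz_inj].
Qed.

Lemma continuous_translateN (g : R -> R[i]) (a : R) : continuous (g : R -> R[i]^o) ->
  continuous ((fun t => g (t - a)) : R -> R[i]^o).
Proof. exact: (@continuous_translate R g (- a)). Qed.

Lemma stftZ (h : R -> R[i]) (M : R) (w : R[i]) z : continuous (h : R -> R[i]^o) ->
  (forall t, normc (h t) <= M) -> stft (fun t => w * h t) z = w * stft h z.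
Proof.
move=> ch hM; rewrite stft_fourier /fourier.
have I := amalgam_integrable (amalgam_fourier z.2 (amalgam_window z.1 ch hM)).
by rewrite -cintegralZ//; congr cintegral; apply/funext => t; rewrite /window !mulrA.
Qed.

Lemma stft_translate (g : R -> R[i]) (M a : R) z : continuous (g : R -> R[i]^o) ->
  (forall t, normc (g t) <= M) ->
  stft (fun t => g (t - a)) z = expi (- (2 * pi * z.2 * a)) * stft g (z.1 - a, z.2).
Proof.
move=> cg gM; have aw := amalgam_window (z.1 - a) cg gM.
have e : window (fun t => g (t - a)) z.1 = fun t => window g (z.1 - a) (t - a).
  by apply/funext => t; rewrite /window (_ : t - a - (z.1 - a) = t - z.1)//; ring.
apply: etrans (congr1 (fun h => fourier h z.2) e) _.
apply: etrans (fourier_translate (- a) z.2 aw) _.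
by congr (expi _ * _); exact: mulrN.
Qed.

Lemma stftB (f h : R -> R[i]) (M N : R) z : continuous (f : R -> R[i]^o) ->
  (forall t, normc (f t) <= M) -> continuous (h : R -> R[i]^o) ->
  (forall t, normc (h t) <= N) -> stft (fun t => f t - h t) z = stft f z - stft h z.
Proof.
move=> cf fM ch hM.
have I1 := amalgam_integrable (amalgam_fourier z.2 (amalgam_window z.1 cf fM)).
have I2 := amalgam_integrable (amalgam_fourier z.2 (amalgam_window z.1 ch hM)).
rewrite !stft_fourier /fourier -[X in _ - X]mul1r -mulNr -cintegralZ// -cintegralD//.
  by congr cintegral; apply/funext => t; rewrite /window; ring.
exact: cintegrableZ.
Qed.

Lemma stft_sum (J : Type) (r : seq J) (F : J -> R -> R[i]) (M : J -> R) z :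
  (forall i, continuous (F i : R -> R[i]^o)) -> (forall i t, normc (F i t) <= M i) ->
  stft (fun t => \sum_(i <- r) F i t) z = \sum_(i <- r) stft (F i) z.
Proof.
move=> cF FM; rewrite stft_fourier /fourier.
have I i := amalgam_integrable (amalgam_fourier z.2 (amalgam_window z.1 (cF i) (FM i))).
rewrite -cintegral_sum//; congr cintegral; apply/funext => t.
by rewrite /window mulr_suml mulr_suml.
Qed.

(** At the centre of its window a windowed function takes the value g(t), since the
Gaussian is 1 there; its Fourier transform is dominated by the row floor t of the cell
bounds of the short-time Fourier transform of g, and the rows have summable sums. *)
Lemma S0_amalgam (g : R -> R[i]) : S0 g -> amalgam g.
Proof.
move=> [Cbg W2g]; have [M gM] := Cb_bound Cbg; have [cg _] := Cbg.
split=> //; have [c [c0 cfin] sc] := W2_celldom2 W2g.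
have E : \esum_(n in [set: int * int]) c n =
    \esum_(k in [set: int]) \esum_(l in [set: int]) c (k, l).
  by rewrite -(@esum_pair _ _ _ (fun k l => c (k, l)))//; apply: eq_esum => -[].
have sd : nnsummable (fun k : int => \esum_(l in [set: int]) c (k, l)).
  by split; [move=> k; exact: esum_ge0|rewrite -E].
exists (fun k : int => \esum_(l in [set: int]) c (k, l)) => // t.
have sl : nnsummable (fun l : int => c (Num.floor t, l)).
  by split=> //; exact: nnsummable_lty sd.
have := normc_le_fourier t (amalgam_window t cg gM) sl.
rewrite windowE subrr /gauss expr0n mulr0 oppr0 expR0 mulr1; apply => s.
exact: (sc (t, s)).
Qed.

End Gauss.

(** * The norm of S0 *)

(** The integral of a nonnegative function is a supremum over simple functions below
it, so monotonicity holds without measurability. *)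
Lemma ge0_integral_mono d (T : measurableType d) (R : realType)
    (mu : {measure set T -> \bar R}) (f g : T -> \bar R) :
  (forall x, 0 <= f x)%E -> (forall x, f x <= g x)%E ->
  (\int[mu]_x f x <= \int[mu]_x g x)%E.
Proof.
move=> f0 fg; have g0 x : (0 <= g x)%E by exact: le_trans (f0 x) (fg x).
rewrite !ge0_integralTE//; apply: ge_ereal_sup => _ [h hf <-].
by apply: ereal_sup_ubound; exists h => // x; exact: le_trans (hf x) (fg x).
Qed.

Section S0norm.
Context {R : realType}.
Notation mu := (@lebesgue_measure R).

Definition floor2 (z : measurableTypeR R * measurableTypeR R) : int * int :=
  (Num.floor (z.1 : R), Num.floor (z.2 : R)).

Lemma floor2_fibre n : floor2 @^-1` [set n] =
  (fun t : R => Num.floor t) @^-1` [set n.1] `*` (fun t : R => Num.floor t) @^-1` [set n.2].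
Proof.
by case: n => n1 n2; apply/seteqP; split => -[x y]; rewrite /floor2/=; [case=> -> ->|case=> -> ->].
Qed.

Lemma measurable_floor2 n : measurable (floor2 @^-1` [set n]).
Proof.
by rewrite floor2_fibre; apply: measurableX; exact: measurable_floor_fibre.
Qed.

(** The weight, viewed as a step function on the plane, is constant on unit squares, which
have measure 1. *)
Lemma S0_norm_le (h : R -> R[i]) (c : int * int -> \bar R) :
  (forall n, 0 <= c n)%E -> celldom2 c (stft h) ->
  (S0_norm h <= \esum_(n in [set: int * int]) c n)%E.
Proof.
move=> c0 hc; rewrite /S0_norm.
apply: (@le_trans _ _ (\int[(mu \x mu)]_z c (floor2 z))%E).
  apply: ge0_integral_mono; first by move=> z; rewrite lee_fin normc_ge0.
  exact: hc.
rewrite (@ge0_integral_fibre _ _ R (mu \x mu)%E (int * int)%type floor2 (fun z => c (floor2 z)))//.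
- apply: le_esum => n _.
  rewrite (eq_integral (fun=> c n)); last by move=> z; rewrite in_setE /= => ->.
  rewrite integral_cst//; last exact: measurable_floor2.
  rewrite [X in (_ * X)%E](_ : _ = 1%E) ?mule1// floor2_fibre.
  apply: etrans (product_measure1E _ _ _ _) _; try exact: measurable_floor_fibre.
  by rewrite [X in (X * _)%E](lebesgue_measure_floor_fibre n.1) mul1e; exact: lebesgue_measure_floor_fibre.
- exact: measurable_floor2.
- move=> _ Y _; rewrite setTI.
  rewrite (_ : _ @^-1` Y = \bigcup_n (if `[< Y (c n) >] then floor2 @^-1` [set n] else set0)).
    apply: countable_bigcupT_measurable; first exact: countableP.
    by move=> n; case: ifP => // _; exact: measurable_floor2.
  apply/seteqP; split => z /=.
    by move=> Yz; exists (floor2 z) => //; case: asboolP.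
  by move=> [n _]; case: asboolP => //= Yn ->.
Qed.

End S0norm.

(** * Sampling a band-limited function *)

Section Sampling.
Context {R : realType}.
Implicit Types f g : R -> R[i].

(** A lattice point lies in its own block, so its value is bounded by the block weight. *)
Lemma nnsummable_samples f (a : R) : 0 < a -> amalgam f ->
  nnsummable (fun k : int => (normc (f (a * k%:~R)))%:E).
Proof.
move=> a0 [_ [c sc fc]]; have [b sb cb] := block_majorant a0 sc.
split; first by move=> k; rewrite lee_fin normc_ge0.
apply: le_lt_trans sb.2; apply: le_esum => k _.
apply: le_trans (fc _) (le_trans (cb _) _).
rewrite (_ : block a _ = k)// /block mulrC mulKf ?gt_eqF//.
by apply/eqP; rewrite floor_eq intrD; apply/andP; split; lra.
Qed.

Lemma fourier_bound f : amalgam f -> exists2 B : R, 0 <= B & forall s, normc (fourier f s) <= B.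
Proof.
move=> [cf [c sc fc]].
have cfin : \esum_(k in [set: int]) c k \is a fin_num.
  by have [c0 cfin] := sc; rewrite ge0_fin_numE ?esum_ge0.
exists (2%:R * fine (\esum_(k in [set: int]) c k)).
  by rewrite mulr_ge0// fine_ge0// esum_ge0// => k _; exact: sc.1.
move=> s; rewrite -lee_fin EFinM fineK//; apply: cintegral_le sc _.
  by under eq_fun do rewrite -mulNr; apply: continuous_mulc cf (@continuous_expi R _).
by move=> t; rewrite normcM normc_expi mulr1.
Qed.

Lemma supp_eq0 (h : R -> R[i]) (A : set R) s : supp h `<=` A -> ~ A s -> h s = 0.
Proof.
move=> hA As; apply/eqP; apply: contrapT => /negP hs; apply/As/hA.
exact: subset_closure.
Qed.

Lemma fourier_modulate f (s r : R) :
  fourier (fun t => f t * expi (- (2 * pi * s * t))) r = fourier f (s + r).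
Proof.
rewrite /fourier; congr cintegral; apply/funext => t.
by rewrite -mulrA -expiD; congr (_ * expi _); ring.
Qed.

(** Modulating f by e^{-2 pi i s t} turns the Fejer mean for the lattice (1/beta) Z into 1/m
times a sum of values \hat f(s + n beta), where n = 0 occurs m times and the values with
n != 0 vanish: every Fejer mean equals \hat f(s) exactly. *)
Lemma bandlimited_poisson f (beta s : R) (F : {fset int}) : 0 < beta -> amalgam f ->
  (forall r, beta / 2 <= `|r| -> fourier f r = 0) -> `|s| <= beta / 2 ->
  ((normc (fourier f s - (beta^-1)%:C *
      \sum_(k <- F) f (beta^-1 * k%:~R) * expi (- (2 * pi * s * (beta^-1 * k%:~R)))))%:E <=
   (beta^-1)%:E * tail (fun k => (normc (f (beta^-1 * k%:~R)))%:E) F)%E.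
Proof.
move=> b0 af f0 sb; have a0 : 0 < beta^-1 by rewrite invr_gt0.
pose phi t := f t * expi (- (2 * pi * s * t)).
have h m : (0 < m)%N -> normc (fejer_mean beta^-1 m phi - fourier f s) <= 0.
  move=> m0; rewrite /fejer_mean (eq_bigr (fun=> fourier f s)).
    rewrite sumr_const card_ord -[fourier f s *+ m]mulr_natl mulrA.
    have -> : (m%:R^-1)%:C * m%:R = 1 :> R[i].
      rewrite rmorphV ?unitfE ?pnatr_eq0 -?lt0n//= rmorph_nat mulVf//.
      by rewrite pnatr_eq0 -lt0n.
    by rewrite mul1r subrr normc0.
  move=> j _; rewrite (bigD1 j)//= subrr mul0r fourier_modulate addr0 big1 ?addr0// => l lj.
  rewrite fourier_modulate invrK f0//.
  have n1 : 1 <= `|(j%:Z - l%:Z)%:~R : R|.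
    rewrite -intr_norm -[1]/(1%:~R) ler_int -gtz0_ge1 normr_gt0 subr_eq0.
    by apply: contra lj => /eqP[] jl; apply/eqP/val_inj.
  have : beta <= `|(j%:R - l%:R) * beta|.
    rewrite normrM (gtr0_norm b0); apply: ler_peMl; first exact: ltW.
    by move: n1; rewrite intrB.
  have := ler_normB (s + (j%:R - l%:R) * beta) s; rewrite addrAC subrr add0r.
  by lra.
have := poisson_ineq a0 (amalgam_fourier s af) h F.
rewrite add0e; congr (_ <= _ * _)%E; apply: eq_esum => k _.
by rewrite normcM normc_expi mulr1.
Qed.

Lemma nnsummable_range (p q : int) : nnsummable (fun l : int => if (p <= l <= q)%R then 1%E else 0%E : \bar R).
Proof.
split; first by move=> l; case: ifP.
pose n := `|q - p|.+1%N.
pose w (l : int) (i : 'I_n) : \bar R := if l \in [set p + i%:Z]%classic then 1%E else 0%E.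
have le : (\esum_(l in [set: int]) (if (p <= l <= q)%R then 1%E else 0%E : \bar R) <=
    \esum_(l in [set: int]) \sum_(i < n) w l i)%E.
  apply: le_esum => l _; case: ifPn => [pq|_]; last by apply: sume_ge0 => i _; rewrite /w; case: ifP.
  have li : (`|l - p| < n)%N by rewrite /n; lia.
  rewrite (bigD1 (Ordinal li))//= /w mem_set/=; last by lia.
  by rewrite leeDl// sume_ge0// => i _; case: ifP.
apply: le_lt_trans le _; rewrite esum_sum; last by move=> l i _ _; rewrite /w; case: ifP.
rewrite (eq_bigr (fun=> 1%E)); last by move=> i _; rewrite -esum_mkcond esum_set1.
by rewrite sumEFin ltry.
Qed.

Section Key.
Variables (I : set R) (beta : R) (f g : R -> R[i]).
Hypotheses (b0 : 0 < beta) (hI : I `<=` `]- (beta / 2), (beta / 2)[)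
  (af : amalgam f) (ag : amalgam g) (hg1 : forall s, I s -> fourier g s = 1)
  (hgs : supp (fourier g) `<=` `[- (beta / 2), (beta / 2)])
  (hfs : supp (fourier f) `<=` I).

Notation x_ k := (beta^-1 * k%:~R).
Definition samples (k : int) : \bar R := (normc (f (beta^-1 * k%:~R)))%:E.

(** Let phi be f - (1/beta) times the partial sum.  Its Fourier transform vanishes outside
[-beta/2, beta/2] and is bounded there by [bandlimited_poisson]: on I, where
\hat g = 1, directly; at the other points of the band \hat f = 0, and the bound gets
multiplied by a bound B of |\hat g|. *)
Lemma sampling_bound : exists2 C : R, 0 <= C & forall (F : {fset int}) t,
  ((normc (beta%:C * f t - \sum_(k <- F) f (x_ k) * g (t - x_ k)))%:E <=
    C%:E * tail samples F)%E.
Proof.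
have a0 : 0 < beta^-1 by rewrite invr_gt0.
have [B B0 gB] := fourier_bound ag.
pose p := Num.floor (- (beta / 2)); pose q := Num.floor (beta / 2).
pose e1 (l : int) : \bar R := if (p <= l <= q)%R then 1%E else 0%E.
have se1 : nnsummable e1 := nnsummable_range p q.
have ss : nnsummable samples := nnsummable_samples a0 af.
have K0 : (0 <= \esum_(l in [set: int]) e1 l)%E by apply: esum_ge0 => l _; exact: se1.1.
have Kfin : \esum_(l in [set: int]) e1 l \is a fin_num by rewrite ge0_fin_numE// se1.2.
exists ((1 + B) * fine (\esum_(l in [set: int]) e1 l)).
  by rewrite mulr_ge0 ?addr_ge0// fine_ge0.
move=> F t.
have tfin : tail samples F \is a fin_num.
  rewrite ge0_fin_numE ?tail_ge0 ?(le_lt_trans (tail_le F ss.1) ss.2)//; exact: ss.1.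
have t0 : 0 <= fine (tail samples F) by rewrite fine_ge0 ?tail_ge0//; exact: ss.1.
(* Dividing the remainder by beta makes its transform a difference with \hat f itself. *)
pose phi t := f t - (beta^-1)%:C * \sum_(k <- F) f (x_ k) * g (t - x_ k).
have au k : amalgam (fun t => f (x_ k) * g (t - x_ k)).
  exact: (amalgamZ _ (amalgam_translate (- x_ k) ag)).
have asum : amalgam (fun t => \sum_(k <- F) f (x_ k) * g (t - x_ k)) by exact: amalgam_sum.
have aphi : amalgam phi.
  have := amalgamD af (amalgamZ (- (beta^-1)%:C) asum).
  by congr amalgam; apply/funext => v; rewrite /phi mulNr.
have phihat s : fourier phi s = fourier f s - (beta^-1)%:C *
    (\sum_(k <- F) f (x_ k) * expi (- (2 * pi * s * x_ k))) * fourier g s.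
  have Iu k := amalgam_integrable (amalgam_fourier s (au k)).
  have Is := amalgam_integrable (amalgam_fourier s asum).
  have If := amalgam_integrable (amalgam_fourier s af).
  have -> : fourier phi s = fourier f s + (- (beta^-1)%:C) *
      fourier (fun t => \sum_(k <- F) f (x_ k) * g (t - x_ k)) s.
    rewrite /fourier -cintegralZ// -cintegralD//; last exact: cintegrableZ.
    by congr cintegral; apply/funext => v; rewrite /phi; ring.
  rewrite mulNr -mulrA; congr (_ - _ * _); rewrite mulr_suml /fourier.
  under eq_fun do rewrite mulr_suml.
  rewrite cintegral_sum//; apply: eq_bigr => k _.
  have Ig := amalgam_integrable (amalgam_fourier s (@amalgam_translate R g (- x_ k) ag)).
  have := fourier_translate (- x_ k) s ag; rewrite mulrN => ft.
  rewrite -[RHS]mulrA -ft.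
  by rewrite /fourier -cintegralZ//; congr cintegral; apply/funext => v; rewrite mulrA.
have f0 r : beta / 2 <= `|r| -> fourier f r = 0.
  move=> br; apply: (supp_eq0 hfs) => /hI /=; rewrite in_itv/= -ltr_norml.
  by rewrite ltNge br.
pose E := (1 + B) * beta^-1 * fine (tail samples F).
have E0 : 0 <= E by rewrite !mulr_ge0 ?addr_ge0// ltW.
have hd : celldom (fun l => E%:E * e1 l)%E (fourier phi).
  move=> s; have [sb|sb] := leP `|s| (beta / 2); last first.
    rewrite phihat f0; last exact: ltW.
    rewrite (supp_eq0 hgs); last by rewrite /= in_itv/= -ler_norml leNgt sb.
    by rewrite mulr0 subr0 normc0 mule_ge0 ?lee_fin// se1.1.
  have -> : e1 (Num.floor s) = 1%E.
    by move: sb; rewrite ler_norml /e1 => /andP[s1 s2]; rewrite !le_floor.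
  rewrite mule1 phihat lee_fin.
  have := bandlimited_poisson F b0 af f0 sb; rewrite -/samples -(fineK tfin) -EFinM lee_fin.
  set D := _%:C * _ => hD.
  have at0 : 0 <= beta^-1 * fine (tail samples F) by rewrite mulr_ge0// ltW.
  rewrite /E -mulrA mulrDl mul1r.
  have [Is|Is] := pselect (I s).
    by rewrite hg1// mulr1 (le_trans hD)// lerDl mulr_ge0.
  move: hD; rewrite (supp_eq0 hfs Is) !sub0r !normcN => hD.
  rewrite -[leLHS]add0r lerD// normcM mulrC; apply: ler_pM => //; exact: normc_ge0.
have := normc_le_fourier t aphi (nnsummableZ E0 se1) hd.
rewrite esumZl//; last exact: se1.1.
rewrite -(fineK Kfin) -(fineK tfin) -!EFinM !lee_fin => h.
have -> : beta%:C * f t - \sum_(k <- F) f (x_ k) * g (t - x_ k) = beta%:C * phi t.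
  rewrite /phi mulrBr mulrA -rmorphM/= mulfV ?gt_eqF// rmorph1 mul1r//.
rewrite normcM normc_real gtr0_norm//.
apply: le_trans (ler_wpM2l (ltW b0) h) _; rewrite /E fineK// le_eqVlt; apply/orP; left; apply/eqP.
by field; rewrite gt_eqF.
Qed.

End Key.
End Sampling.

(** * Convergence of series from tails *)

#[local] Existing Instance summability.totally_filter.

Section Series.
Context {R : realType}.

(** Any error estimate that vanishes with the tail identifies x as the sum of the y k;
the remainder is then a sum over the indices outside F. *)
Lemma tail_remainder (J : choiceType) (a : J -> \bar R) (C : R) (x : R[i]) (y : J -> R[i]) :
  nnsummable a -> 0 <= C ->
  (forall F : {fset J}, ((normc (x - \sum_(k <- F) y k))%:E <= C%:E * tail a F)%E) ->
  forall F : {fset J}, ((normc (x - \sum_(k <- F) y k))%:E <=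
    tail (fun k => (normc (y k))%:E) F)%E.
Proof.
move=> sa C0 h F; apply/lee_addgt0Pr => e e0.
have eC : 0 < e / (C + 1) by rewrite divr_gt0// ltr_wpDl.
have [F0 /(_ (F0 `|` F)%fset (fsubsetUl _ _)) tl] := tail_small sa.1 sa.2 eC.
have -> : x - \sum_(k <- F) y k = \sum_(k <- ((F0 `|` F) `\` F)%fset) y k +
    (x - \sum_(k <- (F0 `|` F)%fset) y k).
  by rewrite (sum_fset_sub _ (fsubsetUr F0 F)); ring.
apply: (@le_trans _ _ ((normc (\sum_(k <- ((F0 `|` F) `\` F)%fset) y k))%:E +
    (normc (x - \sum_(k <- (F0 `|` F)%fset) y k))%:E)%E).
  by rewrite -EFinD lee_fin le_normcD.
apply: leeD; first exact: normc_sum_tail.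
apply: le_trans (h _) _; apply: (@le_trans _ _ (C%:E * (e / (C + 1))%:E)%E).
  by apply: lee_wpmul2l; [rewrite lee_fin|exact: ltW].
rewrite -EFinM lee_fin mulrA ler_pdivrMr ?ltr_wpDl//; nra.
Qed.

Lemma esum_tail_weight (J K : choiceType) (r : J -> R) (w : J -> K -> \bar R) (C : R) (F : {fset J}) :
  (forall k, 0 <= r k) -> (forall k n, 0 <= w k n)%E -> 0 <= C ->
  (forall k, \esum_(n in [set: K]) w k n <= C%:E)%E ->
  (\esum_(n in [set: K]) \esum_(k in ~` [set` F]) ((r k)%:E * w k n) <=
    C%:E * tail (fun k => (r k)%:E) F)%E.
Proof.
move=> r0 w0 C0 wC.
rewrite esum_swap; last by move=> n k; rewrite mule_ge0 ?lee_fin.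
rewrite /tail -esumZl//; apply: le_esum => k _.
by rewrite esumZl// muleC; apply: lee_wpmul2r; rewrite ?lee_fin.
Qed.

Lemma partial_sumE (J : choiceType) (T : Type) (u : J -> T -> R[i]) (F : {fset J}) t :
  summability.partial_sum u F t = \sum_(k <- F) u k t.
Proof. by rewrite /summability.partial_sum fct_sumE big_seq_fsetE. Qed.

Lemma partial_sum_seqE (J : choiceType) (y : J -> R[i]) (F : {fset J}) :
  summability.partial_sum y F = \sum_(k <- F) y k.
Proof. by rewrite /summability.partial_sum big_seq_fsetE. Qed.

(** Every convergence in the theorem is reduced to this comparison with a tail. *)
Lemma series_cvg_tail (J : choiceType) (a : J -> \bar R) (C : R) (N : {fset J} -> \bar R) :
  nnsummable a -> 0 <= C -> (forall F, 0 <= N F)%E ->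
  (forall F, N F <= C%:E * tail a F)%E -> N F @[F --> summability.totally] --> 0%E.
Proof.
move=> sa C0 N0 NC.
have near_small (e : R) : 0 < e -> \forall F \near summability.totally, (N F < e%:E)%E.
  move=> e0; have eC : 0 < e / (C + 1) by rewrite divr_gt0// ltr_wpDl.
  have [F0 h] := tail_small sa.1 sa.2 eC.
  exists F0 => // F /= /h tl; apply: le_lt_trans (NC F) _.
  apply: (@le_lt_trans _ _ (C%:E * (e / (C + 1))%:E)%E).
    by apply: lee_wpmul2l; [rewrite lee_fin|exact: ltW].
  by rewrite -EFinM lte_fin mulrA ltr_pdivrMr ?ltr_wpDl//; nra.
apply/fine_cvgP; split.
  apply: filterS (near_small 1 ltr01) => F NF.
  by rewrite ge0_fin_numE// (lt_trans NF)// ltry.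
apply/cvgrPdist_lt => e e0; apply: filterS (near_small e e0) => F NF /=.
rewrite sub0r normrN ger0_norm ?fine_ge0// -lte_fin fineK//.
by rewrite ge0_fin_numE// (lt_trans NF)// ltry.
Qed.

(** Only finitely many cells carry a bound above a given e. *)
Lemma amalgam_C0 (f : R -> R[i]) : amalgam f -> C0 f.
Proof.
move=> [cf [c sc fc]].
have key (e : R) : 0 < e -> exists N : int, forall t, N%:~R < `|t| -> normc (f t) < e.
  move=> e0; have [F0 /(_ F0 (fsubset_refl _)) tl] := tail_small sc.1 sc.2 e0.
  exists ((\sum_(k <- F0) `|k|)%N%:Z + 1) => t ht.
  rewrite -lte_fin; apply: le_lt_trans (fc t) (le_lt_trans _ tl).
  rewrite -(esum_set1 (t := Num.floor t)); last exact: sc.1.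
  apply: esum_subset; first exact: sc.1.
  move=> _ /= -> fF.
  have : (`|Num.floor t| <= \sum_(k <- F0) `|k|)%N by rewrite (big_fsetD1 _ fF)//= leq_addr.
  set n := (\sum_(k <- F0) _)%N in ht *; move=> hn.
  have := floor_le t; have := floorD1_gt t.
  have : `|t| < (Num.floor t)%:~R + 1 \/ `|t| <= - (Num.floor t)%:~R :> R.
    have [t0|t0] := ger0P t; [left|right]; have := floor_le t; have := floorD1_gt t.
      by rewrite intrD.
    by rewrite lerN2.
  move=> h _ _.
  have nR : `|(Num.floor t)%:~R : R| <= n%:Z%:~R.
    by rewrite -intr_norm ler_int -abszE lez_nat.
  move: ht; rewrite intrD; move: nR; rewrite ler_norml => /andP[].
  by case: h; lra.
split=> //; apply/cvg_normcP => e /key[N hN].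
  near=> t; rewrite subr0; apply: hN; apply: lt_le_trans (ler_norm t).
  by near: t; exact: nbhs_pinfty_gt.
near=> t; rewrite subr0; apply: hN; rewrite -normrN; apply: lt_le_trans (ler_norm _).
rewrite ltrNr; near: t; exact: nbhs_ninfty_lt.
Unshelve. all: by end_near. Qed.

Lemma continuous_uniform_limit (T : topologicalType) (f : T -> R[i]) :
  (forall e : R, 0 < e -> exists2 p : T -> R[i], continuous (p : T -> R[i]^o) &
    forall z, normc (f z - p z) <= e) -> continuous (f : T -> R[i]^o).
Proof.
move=> h z; apply/cvg_normcP => e e0.
have e4 : 0 < e / 4 by rewrite divr_gt0.
have [p cp fp] := h _ e4; have /cvg_normcP/(_ _ e4) := cp z; apply: filterS => v pv.
have -> : f v - f z = (f v - p v) + ((p v - p z) - (f z - p z)) by ring.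
rewrite (le_lt_trans (le_normcD _ _))//.
have := le_normcD (p v - p z) (- (f z - p z)); rewrite normcN.
have := fp v; have := fp z; lra.
Qed.

Lemma continuous_sumc (T : topologicalType) (J : Type) (r : seq J) (F : J -> T -> R[i]) :
  (forall i, continuous (F i : T -> R[i]^o)) ->
  continuous ((fun t => \sum_(i <- r) F i t) : T -> R[i]^o).
Proof.
move=> cF; elim: r => [|i r IH].
  by under eq_fun do rewrite big_nil; exact: continuous_cstc.
by under eq_fun do rewrite big_cons; exact: (continuous_addc (cF i) IH).
Qed.

End Series.

(** * Convergence in the three norms *)

Lemma continuous_shear (R : realType) (a : R) : continuous (fun z : R * R => (z.1 - a, z.2)).
Proof.
move=> z.
have c1 : (fun z : R * R => z.1 - a) v @[v --> z] --> z.1 - a.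
  by apply: cvgB; [exact: cvg_fst|exact: cvg_cst].
have c2 : (fun z : R * R => z.2) v @[v --> z] --> z.2 by exact: cvg_snd.
exact: (cvg_pair c1 c2).
Qed.

Section Convergence.
Context {R : realType}.
Variables (r : int -> R[i]) (x : int -> R) (g S : R -> R[i]) (C : R).
Let a k : \bar R := (normc (r k))%:E.
Let u (k : int) (t : R) : R[i] := r k * g (t - x k).
Hypotheses (sa : nnsummable a) (Sg : S0 g) (aS : amalgam S) (hC0 : 0 <= C)
  (hC : forall (F : {fset int}) t,
     ((normc (S t - \sum_(k <- F) u k t))%:E <= C%:E * tail a F)%E).

Let r0 k : 0 <= normc (r k). Proof. exact: normc_ge0. Qed.
Let ag : amalgam g. Proof. exact: S0_amalgam. Qed.

Lemma amalgam_bound (h : R -> R[i]) : amalgam h -> exists M, forall t, normc (h t) <= M.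
Proof. by move=> /amalgam_W1 [Ch _]; exact: Cb_bound. Qed.

Let au k : amalgam (u k).
Proof. exact: (amalgamZ _ (amalgam_translate (- x k) ag)). Qed.

Let remainderE (F : {fset int}) :
  S - summability.partial_sum u F = fun t => S t - \sum_(k <- F) u k t.
Proof. by apply/funext => t; rewrite -partial_sumE. Qed.

Lemma partial_sum_fset0 : S - summability.partial_sum u fset0 = S.
Proof. by rewrite remainderE; apply/funext => t; rewrite big_seq_fset0 subr0. Qed.

Lemma sum_norms_lty (N : (R -> R[i]) -> \bar R) (K : R) : 0 <= K ->
  (forall k, (N (u k) <= K%:E * a k)%E) -> (\esum_(k in [set: int]) N (u k) < +oo)%E.
Proof.
move=> K0 NK; apply: (@le_lt_trans _ _ (\esum_(k in [set: int]) K%:E * a k)%E).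
  by apply: le_esum => k _; exact: NK.
exact: (nnsummableZ K0 sa).2.
Qed.

Lemma sup_cvg : abs_series_cvg supnorm C0 u S.
Proof.
have [M gM] := amalgam_bound ag.
have M0 : 0 <= M by apply: le_trans (gM 0); exact: normc_ge0.
split.
- by move=> k; exact: amalgam_C0.
- exact: amalgam_C0.
- apply: (sum_norms_lty M0) => k; apply: supnorm_le => t.
  by rewrite /u normcM mulrC -EFinM lee_fin ler_wpM2r.
- apply: (series_cvg_tail sa hC0) => F.
    by apply: le_trans (supnorm_ge _ 0); rewrite lee_fin normc_ge0.
  by apply: supnorm_le => t; rewrite remainderE; exact: hC.
Qed.

(** The cell bounds of the remainder are superpositions of translated cell bounds of g. *)
Lemma W1_cvg : abs_series_cvg W1_norm W1 u S.
Proof.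
have [cg [c sc gc]] := ag; have [c0 _] := sc.
pose w k n := shift_weight +%R (Num.floor (- x k)) c n.
have w0 k n : (0 <= w k n)%E by exact: shift_weight_ge0.
have cfin : \esum_(n in [set: int]) c n \is a fin_num by rewrite ge0_fin_numE ?esum_ge0 ?sc.2.
pose K := 2%:R * fine (\esum_(n in [set: int]) c n).
have K0 : 0 <= K by rewrite mulr_ge0// fine_ge0// esum_ge0.
have wK k : (\esum_(n in [set: int]) w k n <= K%:E)%E.
  by rewrite /K EFinM fineK//; exact: esum_shift_weight addz_inj.
have uw k t : ((normc (u k t))%:E <= (normc (r k))%:E * w k (Num.floor t))%E.
  by rewrite normcM EFinM; apply: lee_wpmul2l; [rewrite lee_fin|exact: (celldom_translate (- x k) c0 gc)].
have K4 : 0 <= 4%:R * K by rewrite mulr_ge0.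
split.
- by move=> k; exact: amalgam_W1.
- exact: amalgam_W1.
- apply: (sum_norms_lty K4) => k.
  apply: le_trans (W1_norm_le (c := fun n => ((normc (r k))%:E * w k n)%E) _ _) _.
  + by move=> n; rewrite mule_ge0 ?lee_fin.
  + by move=> t; exact: uw.
  rewrite esumZl// EFinM -muleA; apply: lee_wpmul2l; first by rewrite lee_fin.
  by rewrite muleC; apply: lee_wpmul2r; [rewrite lee_fin|exact: wK].
- apply: (series_cvg_tail sa K4) => F.
    by apply: esum_ge0 => n _; apply: le_trans (supnorm_ge _ 0); rewrite lee_fin normc_ge0.
  rewrite remainderE; apply: le_trans (W1_norm_le (c := fun n =>
     (\esum_(k in ~` [set` F]) ((normc (r k))%:E * w k n))%E) _ _) _.
  + by move=> n; apply: esum_ge0 => k _; rewrite mule_ge0 ?lee_fin.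
  + move=> t; apply: le_trans (tail_remainder sa hC0 (fun F => hC F t) F) _.
    by apply: le_esum => k _; exact: uw.
  rewrite EFinM -muleA; apply: lee_wpmul2l; first by rewrite lee_fin.
  exact: esum_tail_weight.
Qed.

(** Translating g by x multiplies its short-time Fourier transform by a phase and
translates it in time, so the argument for W applies to cells of the plane.  The
transform of S is continuous as a uniform limit of finite sums of such translates. *)
Lemma S0_cvg : abs_series_cvg S0_norm S0 u S.
Proof.
have [[cg _] W2g] := Sg; have [cW2g _] := W2g.
have [c [c0 cf] gc] := W2_celldom2 W2g.
have [M gM] := amalgam_bound ag.
have [MS SM] := amalgam_bound aS; have cS : continuous (S : R -> R[i]^o) := aS.1.
have cu k : continuous (u k : R -> R[i]^o) := (au k).1.
have uM k t : normc (u k t) <= normc (r k) * M by rewrite /u normcM ler_wpM2l.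
pose shift1 (n : int * int) (q : int) : int * int := (n.1 + q, n.2).
have shift1_inj q : injective (shift1^~ q).
  by move=> [n1 n2] [m1 m2] [] /addIr -> ->.
pose w k n := shift_weight shift1 (Num.floor (- x k)) c n.
have w0 k n : (0 <= w k n)%E by exact: shift_weight_ge0.
have cfin : \esum_(n in [set: int * int]) c n \is a fin_num by rewrite ge0_fin_numE ?esum_ge0.
pose K := 2%:R * fine (\esum_(n in [set: int * int]) c n).
have K0 : 0 <= K by rewrite mulr_ge0// fine_ge0// esum_ge0.
have wK k : (\esum_(n in [set: int * int]) w k n <= K%:E)%E.
  by rewrite /K EFinM fineK//; exact: esum_shift_weight.
have stftu k z : stft (u k) z =
    r k * (expi (- (2 * pi * z.2 * x k)) * stft g (z.1 - x k, z.2)).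
  rewrite /u (@stftZ R (fun t => g (t - x k)) M (r k) z (@continuous_translateN R g (x k) cg) (fun t => gM (t - x k))).
  by rewrite (@stft_translate R g M (x k) z cg gM).
have uw k z : ((normc (stft (u k) z))%:E <=
    (normc (r k))%:E * w k (Num.floor z.1, Num.floor z.2))%E.
  rewrite stftu !normcM normc_expi mul1r EFinM; apply: lee_wpmul2l; first by rewrite lee_fin.
  apply: le_trans (gc _) _; rewrite /w /shift_weight /shift1 /=.
  by case: (floor_add z.1 (- x k)) => ->; [rewrite leeDl|rewrite leeDr].
have stftD F z : stft (fun t => S t - \sum_(k <- F) u k t) z =
    stft S z - \sum_(k <- F) stft (u k) z.
  have cs : continuous ((fun t => \sum_(k <- F) u k t) : R -> R[i]^o).
    exact: (@continuous_sumc R _ _ _ _ cu).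
  have sM t : normc (\sum_(k <- F) u k t) <= \sum_(k <- F) normc (r k) * M.
    by apply: le_trans (normc_sum _ _) _; apply: ler_sum => k _; exact: uM.
  apply: etrans (stftB z cS SM cs sM) _; congr (_ - _).
  exact: (stft_sum F z cu uM).
have [Cs Cs0 hCs] := @stft_bound R.
have CC0 : 0 <= Cs * C by rewrite mulr_ge0.
have tfin (F : {fset int}) : tail a F \is a fin_num.
  rewrite ge0_fin_numE ?tail_ge0 ?(le_lt_trans (tail_le F sa.1) sa.2)//; exact: sa.1.
have hD (F : {fset int}) z : ((normc (stft S z - \sum_(k <- F) stft (u k) z))%:E <= (Cs * C)%:E * tail a F)%E.
  rewrite -stftD -(fineK (tfin F)) -EFinM lee_fin -mulrA; apply: hCs.
    rewrite (_ : (fun t => _) = fun t => S t + -1 * \sum_(k <- F) u k t).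
      exact: (continuous_addc cS (continuous_mulc (@continuous_cstc R _ (-1)) (@continuous_sumc R _ _ _ _ cu))).
    by apply/funext => t; rewrite mulN1r.
  by move=> t; rewrite -lee_fin EFinM fineK.
have dF (F : {fset int}) : celldom2 (fun n => (\esum_(k in ~` [set` F]) ((normc (r k))%:E * w k n))%E)
    (stft (S - summability.partial_sum u F)).
  move=> z; rewrite remainderE stftD.
  apply: le_trans (tail_remainder sa CC0 (fun F => hD F z) F) _.
  by apply: le_esum => k _; exact: uw.
have cF0 (F : {fset int}) n : (0 <= \esum_(k in ~` [set` F]) ((normc (r k))%:E * w k n))%E.
  by apply: esum_ge0 => k _; rewrite mule_ge0 ?lee_fin.
have Cbu k : Cb (u k) by exact: (amalgam_W1 (au k)).1.
have cstftu k : continuous (stft (u k) : R * R -> R[i]^o).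
  rewrite (_ : stft (u k) = fun z => r k * (expi (- (2 * pi * x k) * z.2) *
      stft g (z.1 - x k, z.2))); last first.
    by apply/funext => z; rewrite stftu; congr (_ * (expi _ * _)); ring.
  apply: continuous_mulc; first exact: continuous_cstc.
  apply: continuous_mulc => z.
    apply: (@continuous_comp _ _ _ snd (fun t => expi (- (2 * pi * x k) * t) : R[i]^o)).
      exact: cvg_snd.
    exact: continuous_expi.
  apply: (@continuous_comp _ _ _ (fun z : R * R => (z.1 - x k, z.2)) (stft g : R * R -> R[i]^o)).
    exact: continuous_shear.
  exact: cW2g.1.
have W2c (F : R * R -> R[i]) (M' : R) (d : int * int -> \bar R) : continuous (F : R * R -> R[i]^o) ->
   (forall n, 0 <= d n)%E -> celldom2 d F -> (\esum_(n in [set: int * int]) d n <= M'%:E)%E -> W2 F.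
  move=> cF d0 Fd dM; split.
    split=> //; apply: (@le_lt_trans _ _ M'%:E); last exact: ltry.
    apply: supnorm_le => z; apply: le_trans (Fd z) (le_trans _ dM).
    by rewrite -(esum_set1 (t := (Num.floor z.1, Num.floor z.2)))//; exact: esum_subset.
  apply: (le_lt_trans (W2_norm_le d0 Fd)).
  apply: (@le_lt_trans _ _ (16%:R%:E * M'%:E)%E); last by rewrite -EFinM ltry.
  by apply: lee_wpmul2l; rewrite ?lee_fin.
have uK k : (\esum_(n in [set: int * int]) ((normc (r k))%:E * w k n) <= K%:E * a k)%E.
  by rewrite esumZl// muleC; apply: lee_wpmul2r; [rewrite lee_fin|exact: wK].
split.
- move=> k; split; first exact: Cbu.
  apply: (W2c _ (K * normc (r k)) (fun n => ((normc (r k))%:E * w k n)%E) (cstftu k) _ (uw k)).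
    by move=> n; rewrite mule_ge0 ?lee_fin.
  exact: uK.
- split; first exact: (amalgam_W1 aS).1.
  have := dF fset0; rewrite partial_sum_fset0 => dS.
  apply: (W2c _ (K * fine (tail a fset0)) _ _ (cF0 fset0) dS).
    apply: continuous_uniform_limit => e e0.
    have eC : 0 < e / (Cs * C + 1) by rewrite divr_gt0// ltr_wpDl.
    have [F /(_ F (fsubset_refl _)) tl] := tail_small sa.1 sa.2 eC.
    exists (fun z => \sum_(k <- F) stft (u k) z); first exact: continuous_sumc.
    move=> z; rewrite -lee_fin; apply: le_trans (hD F z) _.
    apply: (@le_trans _ _ ((Cs * C)%:E * (e / (Cs * C + 1))%:E)%E).
      by apply: lee_wpmul2l; [rewrite lee_fin|exact: ltW].
    by rewrite -EFinM lee_fin mulrA ler_pdivrMr ?ltr_wpDl//; nra.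
  by rewrite EFinM fineK//; exact: esum_tail_weight.
- apply: (sum_norms_lty K0) => k.
  apply: le_trans (S0_norm_le (c := fun n => ((normc (r k))%:E * w k n)%E) _ _) (uK k).
    by move=> n; rewrite mule_ge0 ?lee_fin.
  by move=> z; exact: uw.
- apply: (series_cvg_tail sa K0) => F.
    by apply: integral_ge0 => z _; rewrite lee_fin normc_ge0.
  apply: le_trans (S0_norm_le (cF0 F) (dF F)) _.
  exact: esum_tail_weight.
Qed.

Lemma pointwise_cvg t : series_cvg (fun z => (normc z)%:E) (u ^~ t) (S t).
Proof.
apply: (series_cvg_tail sa hC0) => F; first by rewrite lee_fin normc_ge0.
by rewrite partial_sum_seqE; exact: hC.
Qed.

End Convergence.

Theorem theorem10p1 (R : realType) (I : set R) (beta : R)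
    (hI : is_interval I) (hbeta : 0 < beta)
    (hIbeta : I `<=` `]- (beta / 2), (beta / 2)[)
    (g : R -> R[i]) (hg : S0 g)
    (hg1 : forall s, I s -> fourier g s = 1)
    (hgsupp : supp (fourier g) `<=` `[- (beta / 2), (beta / 2)])
    (alpha : R) (halpha : alpha = beta^-1)
    (f : R -> R[i]) (hf : B1 I f) :
  let u : int -> R -> R[i] :=
    fun k t => f (alpha * k%:~R) * g (t - alpha * k%:~R) in
  exists S : R -> R[i],
    [/\ forall t, series_cvg (fun z => (normc z)%:E) (u ^~ t) (S t),
        forall t, f t = alpha%:C * S t,
        abs_series_cvg S0_norm S0 u S,
        abs_series_cvg W1_norm W1 u S &
        abs_series_cvg supnorm C0 u S].
Proof.
move=> u; subst alpha; have [W1f fsupp] := hf.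
have af := W1_amalgam W1f.
have sa : nnsummable (samples beta f) by apply: nnsummable_samples => //; rewrite invr_gt0.
have [C hC0 hC] := sampling_bound hbeta hIbeta af (S0_amalgam hg) hg1 hgsupp fsupp.
have aS := amalgamZ beta%:C af.
exists (fun t => beta%:C * f t); split.
- by move=> t; exact: (pointwise_cvg sa hC0 hC).
- by move=> t; rewrite mulrA -rmorphM/= mulVf ?gt_eqF// rmorph1 mul1r.
- exact: (S0_cvg sa hg aS hC0 hC).
- exact: (W1_cvg sa hg aS hC0 hC).
- exact: (sup_cvg sa hg aS hC0 hC).
Qed.
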